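(* The following problem is PSPACE-hard: given a deterministic single-path linear-constraint loop with precondition interpreted over the integers, decide whether there exists an inductive invariant $\mathcal{I}$ that is a convex polyhedron such that some affine function is a linear ranking function for the set of transitions $\{(\vec x,\vec x') : (\vec x,\vec x')\text{ is a transition of the loop and } \vec x\in\mathcal{I}\}$.
   Context: A single-path linear-constraint loop with precondition over variables $\vec{x}=(x_1,\dots,x_n)^T$ has the form $C\vec{x}\le\vec{c};\ \mathit{while}~(B\vec{x}\le\vec{b})~\mathit{do}~A\binom{\vec{x}}{\vec{x}'}\le\vec{a}$, with integer matrices and vectors (numbers in binary). Over the integers, states range over $\mathbb{Z}^n$; initial states are integer points with $C\vec x\le\vec c$; a transition is an integer pair $(\vec x,\vec x')$ with $B\vec x\le\vec b$ and $A\binom{\vec x}{\vec x'}\le\vec a$. The loop is deterministic if for each $\vec x$ satisfying the guard there is at most one $\vec x'$ satisfying the update. An inductive invariant is a set $\mathcal{I}$ of states containing all initial states and such that for every transition $(\vec x,\vec x')$, $\vec x\in\mathcal I$ implies $\vec x'\in\mathcal I$. A convex polyhedral invariant is one given by a conjunction of linear constraints (the set of integer states satisfying it). An affine function $\rho(\vec x)=\vec\lambda\cdot\vec x+\lambda_0$ is a linear ranking function for a set $T$ of transitions if for every $(\vec x,\vec x')\in T$: $\rho(\vec x)\ge0$ and $\rho(\vec x)-\rho(\vec x')\ge 1$. *)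

(* Defs.v *)
From HB Require Import structures.
From mathcomp Require Import all_boot all_order all_algebra.

Set Implicit Arguments.
Unset Strict Implicit.
Unset Printing Implicit Defensive.

Import Order.TTheory GRing.Theory Num.Theory.
Local Open Scope ring_scope.

Inductive direction := Left | Stay | Right.

(* Deterministic Turing machines with [tm_tapes.+1] one-way infinite tapes;
   the cells of a tape are numbered by nat. *)
Record tm := TM {
  tm_tapes : nat;
  tm_state : finType;
  tm_symbol : finType;
  tm_blank : tm_symbol;
  tm_bit : bool -> tm_symbol;
  tm_bit_inj : injective tm_bit;
  tm_bit_blank : forall b, tm_bit b != tm_blank;
  tm_start : tm_state;
  tm_halting : pred tm_state;
  tm_accepting : pred tm_state;
  tm_delta : tm_state -> {ffun 'I_tm_tapes.+1 -> tm_symbol} ->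
             tm_state * {ffun 'I_tm_tapes.+1 -> tm_symbol * direction}
}.

Record config (M : tm) := Config {
  cfg_state : tm_state M;
  cfg_tape : 'I_(tm_tapes M).+1 -> nat -> tm_symbol M;
  cfg_head : 'I_(tm_tapes M).+1 -> nat
}.

Definition word_tape (M : tm) (w : seq bool) (p : nat) : tm_symbol M :=
  nth (tm_blank M) (map (@tm_bit M) w) p.

Definition init_config (M : tm) (w : seq bool) : config M :=
  Config (tm_start M)
    (fun i p => if i == ord0 then word_tape M w p else tm_blank M)
    (fun=> 0%N).

(* A left move from cell 0 leaves the head on cell 0. *)
Definition move_head (d : direction) (p : nat) : nat :=
  match d with Left => p.-1 | Stay => p | Right => p.+1 end.

Definition step (M : tm) (c : config M) : config M :=
  if tm_halting (cfg_state c) then c else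
  let r := tm_delta (cfg_state c) [ffun i => cfg_tape c i (cfg_head c i)] in
  Config r.1
    (fun i p => if p == cfg_head c i then (r.2 i).1 else cfg_tape c i p)
    (fun i => move_head (r.2 i).2 (cfg_head c i)).

Definition run (M : tm) (w : seq bool) (t : nat) : config M :=
  iter t (@step M) (init_config M w).

Definition halted (M : tm) (c : config M) : bool := tm_halting (cfg_state c).

Definition accepted (M : tm) (c : config M) : bool :=
  halted c && tm_accepting (cfg_state c).

Definition language := seq bool -> Prop.

Definition decides (M : tm) (L : language) : Prop :=
  forall w, exists2 t, halted (run M w t) & accepted (run M w t) <-> L w.

Definition in_space (M : tm) (s : nat -> nat) : Prop :=
  forall w t i, (cfg_head (run M w t) i < s (size w))%N.

Definition PSPACE (L : language) : Prop :=
  exists M : tm, decides M L /\ exists p : {poly nat}, in_space M (horner p).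

(* The input is read from the first tape, the output from the last one. *)
Definition computes_in_time (M : tm) (f : seq bool -> seq bool)
    (s : nat -> nat) : Prop :=
  forall w, exists t, [/\ (t <= s (size w))%N, halted (run M w t) &
    forall p, cfg_tape (run M w t) ord_max p = word_tape M (f w) p].

Definition poly_time (f : seq bool -> seq bool) : Prop :=
  exists M : tm, exists p : {poly nat}, computes_in_time M f (horner p).

(* The problem is: given an instance satisfying [promise], decide [yes].
   Reductions may only produce instances that satisfy the promise. *)
Definition PSPACE_hard (inst : Type) (encode : inst -> seq bool)
    (promise yes : inst -> Prop) : Prop :=
  forall L : language, PSPACE L ->
  exists f : seq bool -> inst,
    [/\ poly_time (encode \o f), forall w, promise (f w) &
        forall w, L w <-> yes (f w)].

Record linsys (R : Type) (n : nat) := LinSys {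
  ls_rows : nat;
  ls_lhs : 'M[R]_(ls_rows, n);
  ls_rhs : 'cV[R]_ls_rows
}.

Definition sat (R : numDomainType) (n : nat) (S : linsys R n)
    (x : 'cV[R]_n) : Prop :=
  forall i, (ls_lhs S *m x) i 0 <= ls_rhs S i 0.

Record loop := Loop {
  loop_dim : nat;
  loop_pre : linsys int loop_dim;
  loop_guard : linsys int loop_dim;
  loop_update : linsys int (loop_dim + loop_dim)
}.

Definition state (l : loop) := 'cV[int]_(loop_dim l).

Definition initial (l : loop) (x : state l) : Prop := sat (loop_pre l) x.

Definition transition (l : loop) (x x' : state l) : Prop :=
  sat (loop_guard l) x /\ sat (loop_update l) (col_mx x x').

Definition deterministic (l : loop) : Prop :=
  forall x : state l, sat (loop_guard l) x ->
  forall x1 x2 : state l, sat (loop_update l) (col_mx x x1) ->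
    sat (loop_update l) (col_mx x x2) -> x1 = x2.

Definition inductive_invariant (l : loop) (I : state l -> Prop) : Prop :=
  (forall x, initial x -> I x) /\
  (forall x x', transition x x' -> I x -> I x').

Definition polyhedral (n : nat) (I : 'cV[int]_n -> Prop) : Prop :=
  exists S : linsys rat n, forall x, I x <-> sat S (map_mx intr x).

Definition affine (n : nat) (lam : 'rV[rat]_n) (lam0 : rat)
    (x : 'cV[int]_n) : rat :=
  (lam *m map_mx intr x) 0 0 + lam0.

Definition linear_ranking (n : nat) (T : 'cV[int]_n -> 'cV[int]_n -> Prop)
    (rho : 'cV[int]_n -> rat) : Prop :=
  forall x x', T x x' -> 0 <= rho x /\ 1 <= rho x - rho x'.

Definition has_ranking_with_invariant (l : loop) : Prop :=
  exists I : state l -> Prop,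
    [/\ inductive_invariant I, polyhedral I &
        exists (lam : 'rV[rat]_(loop_dim l)) (lam0 : rat),
          linear_ranking (fun x x' => transition x x' /\ I x)
            (affine lam lam0)].

(* Binary digits without leading zeros, least significant first; [up_log 2 n.+1]
   is the number of binary digits of [n]. *)
Definition bits (n : nat) : seq bool :=
  mkseq (fun i => odd (n %/ 2 ^ i)) (up_log 2 n.+1).

(* The sign, then each digit of the absolute value preceded by a 1, then a 0. *)
Definition encode_int (z : int) : seq bool :=
  (z < 0) :: flatten [seq [:: true; b] | b <- bits `|z|%N] ++ [:: false].

(* Dimensions are in unary, so that the size of an instance is at least its
   number of variables and of constraints; only coefficients are in binary. *)
Definition encode_dim (n : nat) : seq bool := rcons (nseq n true) false.

(* Each inequality is written as its coefficients followed by its bound. *)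
Definition encode_linsys (n : nat) (S : linsys int n) : seq bool :=
  encode_dim (ls_rows S) ++
  flatten [seq flatten [seq encode_int (ls_lhs S i j) | j <- enum 'I_n] ++
               encode_int (ls_rhs S i 0) | i <- enum 'I_(ls_rows S)].

Definition encode_loop (l : loop) : seq bool :=
  encode_dim (loop_dim l) ++ encode_linsys (loop_pre l) ++
  encode_linsys (loop_guard l) ++ encode_linsys (loop_update l).

Definition prefix_code (T : Type) (e : T -> seq bool) : Prop :=
  forall x y s t, e x ++ s = e y ++ t -> x = y /\ s = t.

Lemma bits_inj : injective bits.
Proof.
have H k : forall m n, (m < 2 ^ k -> n < 2 ^ k ->
  (forall i, i < k -> odd (m %/ 2 ^ i) = odd (n %/ 2 ^ i)) -> m = n)%N.
  elim: k => [|k IH] m n; first by case: m; case: n.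
  move=> mk nk mn.
  rewrite -[m]odd_double_half -[n]odd_double_half.
  have := mn 0%N isT; rewrite !expn0 !divn1 => ->.
  congr (_ + _.*2)%N; apply: IH; rewrite -?divn2.
  - by rewrite ltn_divLR // -expnSr.
  - by rewrite ltn_divLR // -expnSr.
  - by move=> i ik; rewrite -!divnMA -expnS; apply: mn.
move=> m n mn; have /eqP := congr1 size mn; rewrite !size_mkseq => /eqP szE.
have lt2 q : (q < 2 ^ up_log 2 q.+1)%N by apply: up_logP.
apply: (H (up_log 2 m.+1)) => [||i ik]; rewrite ?lt2 //.
  by rewrite szE lt2.
have := congr1 (fun s => nth false s i) mn.
by rewrite /bits !nth_mkseq // -szE.
Qed.

Lemma encode_int_prefix : prefix_code encode_int.
Proof.
move=> x y s t; rewrite /encode_int !cat_cons => -[sxy].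
rewrite -!catA /=.
have H (u v : seq bool) : flatten [seq [:: true; b] | b <- u] ++ false :: s =
    flatten [seq [:: true; b] | b <- v] ++ false :: t -> u = v /\ s = t.
  elim: u v => [|a u IH] [|b v] //=; first by case.
  by case=> -> /IH[-> ->].
move=> /H[/bits_inj xy ->]; split=> //.
by case: x y sxy xy => m [] n //= _ [->].
Qed.

Lemma encode_dim_prefix : prefix_code encode_dim.
Proof.
rewrite /encode_dim => m n s t; rewrite !cat_rcons.
elim: m n => [|m IH] [|n] //=; first by case.
by case=> /IH[-> ->].
Qed.

Lemma encode_flatten_prefix (I : eqType) (T : Type) (e : T -> seq bool)
    (r : seq I) (F G : I -> T) s t :
  prefix_code e ->
  flatten [seq e (F i) | i <- r] ++ s = flatten [seq e (G i) | i <- r] ++ t ->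
  {in r, F =1 G} /\ s = t.
Proof.
move=> eP; elim: r => [|i r IH] //=; rewrite -!catA => /eP[FG /IH[{}IH ->]].
by split=> // j; rewrite inE => /predU1P[->|/IH].
Qed.

Lemma encode_linsys_prefix n : prefix_code (@encode_linsys n).
Proof.
move=> [p A a] [q B b] s t; rewrite /encode_linsys /= -!catA.
case/encode_dim_prefix => pq; case: q / pq B b => B b.
pose e (u : 'rV[int]_n * int) :=
  flatten [seq encode_int (u.1 0 j) | j <- enum 'I_n] ++ encode_int u.2.
pose ineq (C : 'M[int]_(p, n)) (c : 'cV[int]_p) i := (row i C, c i 0).
have eP : prefix_code e.
  move=> [u x] [v y] s' t'; rewrite /e /= -!catA.
  case/(encode_flatten_prefix encode_int_prefix) => uv.
  case/encode_int_prefix => -> ->; split=> //; congr (_, _).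
  by apply/rowP => j; apply: uv; rewrite mem_enum.
have eE (C : 'M[int]_(p, n)) (c : 'cV[int]_p) :
    [seq flatten [seq encode_int (C i j) | j <- enum 'I_n] ++
      encode_int (c i 0) | i <- enum 'I_p] =
    [seq e (ineq C c i) | i <- enum 'I_p].
  apply: eq_map => i; rewrite /e /=; congr (flatten _ ++ _).
  by apply: eq_map => j; rewrite mxE.
rewrite !eE => /(encode_flatten_prefix eP)[AB ->]; split=> //.
have {}AB i : ineq A a i = ineq B b i by apply: AB; rewrite mem_enum.
congr LinSys; first by apply/row_matrixP => i; case: (AB i).
by apply/colP => i; case: (AB i).
Qed.

Lemma encode_loop_inj : injective encode_loop.
Proof.
move=> [m P G U] [n P' G' U']; rewrite /encode_loop /=.
case/encode_dim_prefix => mn; case: n / mn P' G' U' => P' G' U'.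
case/encode_linsys_prefix => -> /encode_linsys_prefix[->].
rewrite -[encode_linsys U]cats0 -[encode_linsys U']cats0.
by case/encode_linsys_prefix => ->.
Qed.

(* Main.v *)
From HB Require Import structures.
Require Import Defs.
From mathcomp Require Import all_boot all_order all_algebra.
From mathcomp Require Import zify ring lra.

(* A machine with polynomial space bound is simulated by a queue: its tape
   cells, all tapes superposed, form a ring that is rotated by one letter per
   iteration, and a finite control performs one machine step per turn of the
   ring.  With letters and control written in dual-rail bits, an iteration is
   the shift x'_j = x_(j+K) together with a fixed Boolean function of boundedly
   many bits, hence is defined by integer linear inequalities; one more variable
   z decreases by 1.  The loop stops iff the machine accepts.  If it does, the
   finitely many reachable states have distinct 0/1 parts, so they are exactly
   the integer points of a polyhedron (cut off every other 0/1 vector, and tie z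
   to the 0/1 part by big-M inequalities), and z + T is a ranking function.
   Otherwise the infinite run excludes ranking functions.  Almost all rows of
   the matrices form homogeneous periodic bands, so the encoding is printed by
   nested loops over the input word, which a Turing machine with one tape per
   nesting level executes in polynomial time. *)

Set Implicit Arguments.
Unset Strict Implicit.
Unset Printing Implicit Defensive.

Import Order.TTheory GRing.Theory Num.Theory.

(** * Nested loops over the input word run in polynomial time *)

(** What shapes the construction is that the whole instance has to be printed by a concrete Turing
    machine. Rotating the queue brings every letter to one fixed window, so a single truth table, of
    a size independent of the input, describes the machine, and the remaining update constraints are
    translates of one row. Dual rails serve the same purpose in the precondition: once all pairs of
    rails are known to add up to 1, a single row that annihilates the rails that are off fixes the
    start word, and the letters of the input appear in no other row. The counter [z] supplies the
    ranking function, as no linear form in the queue bits need decrease along a run. The invariant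
    ties [z] to the queue; it is not part of the instance, so it may have exponentially many
    constraints and exponentially large coefficients. The guard is empty: the loop stops because the
    update has no solution at an accepting control, and determinism therefore has to hold at all
    integer states, codes of queues or not. *)

Inductive gen := Skip | Out of bool | Cat of gen & gen | Rep of gen & gen.

Fixpoint eval (g : gen) (w : seq bool) : seq bool :=
  match g with
  | Skip => [::]
  | Out b => [:: b]
  | Cat g h => eval g w ++ eval h w
  | Rep g h => flatten [seq if b then eval g w else eval h w | b <- w]
  end.

Fixpoint depth (g : gen) : nat :=
  match g with
  | Cat g h => maxn (depth g) (depth h)
  | Rep g h => (maxn (depth g) (depth h)).+1
  | _ => 0
  end.

(* [None] is blank and [Some None] marks cell 0 of the working tapes. *)
Definition symbol : finType := option (option bool).
Notation marker := (Some None : symbol).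
Definition bit (b : bool) : symbol := Some (Some b).

(* An instruction reads the given tape and returns the next address, the move
   of that tape and the bit to be appended to the output. *)
Definition instr := (nat * (symbol -> nat * direction * option bool))%type.

Fixpoint len (g : gen) : nat :=
  match g with
  | Skip => 0
  | Out _ => 1
  | Cat g h => len g + len h
  | Rep g h => 3 + ((len g).+1 + (len h).+1)
  end.

Fixpoint cost (g : gen) (n : nat) : nat :=
  match g with
  | Skip => 0
  | Out _ => 1
  | Cat g h => cost g n + cost h n
  | Rep g h => n * (cost g n + cost h n + 2) + n + 3
  end.

(* Loops of nesting level [l] scan the copy of the input on tape [l]; the code
   is placed at address [a]. *)
Fixpoint compile (l a : nat) (g : gen) : seq instr :=
  match g with
  | Skip => [::]
  | Out b => [:: (1, fun=> (a.+1, Stay, Some b))]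
  | Cat g h => compile l a g ++ compile l (a + len g) h
  | Rep g h =>
    let next := (l, fun=> (a.+1, Right, None)) in
    let b := a + 3 + (len g).+1 in
    [:: next;
        (l, fun s => if s is Some (Some x) then (if x then a + 3 else b, Stay, None)
                     else (a.+2, Left, None));
        (l, fun s => if s == marker then (b + (len h).+1, Stay, None)
                     else (a.+2, Left, None))] ++
    (rcons (compile l.+1 (a + 3) g) next ++ rcons (compile l.+1 b h) next)
  end.

Lemma size_compile l a g : size (compile l a g) = len g.
Proof.
elim: g l a => //= [g IHg h IHh|g IHg h IHh] l a.
  by rewrite size_cat IHg IHh.
by rewrite size_cat !size_rcons IHg IHh.
Qed.

(** * The Turing machine that executes compiled code *)

Section Machine.
Variables (d : nat) (code : seq instr).

Definition pcs : finType := 'I_(size code).+1.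
Definition ctl : finType := (option bool + pcs)%type.

Definition working (j : 'I_d.+3) : bool := (j != ord0) && (j != ord_max).

(** Nested scans need one head each and a recognizable left end, which the input tape lacks; hence
    the marked copies. [inl None] writes the markers, [inl (Some false)] copies the input to all
    working tapes, [inl (Some true)] takes their heads back in step, so that testing tape 1
    suffices, and [inr] runs the code. *)
Definition gen_delta (s : ctl) (r : {ffun 'I_d.+3 -> symbol}) :
    ctl * {ffun 'I_d.+3 -> symbol * direction} :=
  match s with
  | inl None =>
    (inl (Some false),
     [ffun j => if working j then (marker, Right) else (r j, Stay)])
  | inl (Some false) =>
    if r ord0 is Some (Some b) then
      (inl (Some false),
       [ffun j => if working j then (bit b, Right) else
                  (r j, if j == ord0 then Right else Stay)])
    else
      (inl (Some true), [ffun j => (r j, if working j then Left else Stay)])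
  | inl (Some true) =>
    if r (inord 1) == marker then (inr ord0, [ffun j => (r j, Stay)])
    else (inl (Some true), [ffun j => (r j, if working j then Left else Stay)])
  | inr pc =>
    let i := nth (0, fun=> (0, Stay, None)) code pc in
    let: (a, m, o) := i.2 (r (inord i.1)) in
    (inr (inord a),
     [ffun j => if j == ord_max then
                  if o is Some b then (bit b, Right) else (r j, Stay)
                else (r j, if j == i.1 :> nat then m else Stay)])
  end.

Lemma bit_inj : injective bit. Proof. by move=> a b []. Qed.

Lemma bit_blank b : bit b != None. Proof. by []. Qed.

Definition gen_halting (s : ctl) : bool :=
  if s is inr pc then pc == ord_max else false.

Definition gen_tm : tm :=
  @TM d.+2 ctl symbol None bit bit_inj bit_blank (inl None) gen_halting xpred0
      gen_delta.

Variable w : seq bool.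

Definition copy (v : seq bool) (p : nat) : symbol :=
  nth None (marker :: map bit v) p.

Local Notation conf := (config gen_tm).
Local Notation step := (@step gen_tm).

Definition point := (nat * (nat -> nat) * seq bool)%type.

Definition at_point (x : point) (c : conf) : Prop :=
  [/\ cfg_state c = inr (inord x.1.1 : pcs),
      forall j : 'I_d.+3, working j ->
        cfg_tape c j =1 copy w /\ cfg_head c j = x.1.2 j,
      cfg_tape c ord_max =1 word_tape gen_tm x.2 &
      cfg_head c ord_max = size x.2].

Definition leads (n : nat) (x y : point) : Prop :=
  forall c, at_point x c ->
  exists2 t, t <= n & at_point y (iter t step c).

Lemma leads0 x : leads 0 x x.
Proof. by move=> c xc; exists 0. Qed.

Lemma leads_trans n m x y z : leads n x y -> leads m y z -> leads (n + m) x z.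
Proof.
move=> xy yz c /xy[t tn /yz[u um uz]]; exists (u + t).
  by rewrite addnC leq_add.
by rewrite iterD.
Qed.

Lemma leads_leq n m x y : n <= m -> leads n x y -> leads m x y.
Proof. by move=> nm xy c /xy[t tn yc]; exists t => //; apply: leq_trans nm. Qed.

Lemma leads_eqr n x a h h' o : h =1 h' ->
  leads n x (a, h, o) -> leads n x (a, h', o).
Proof.
move=> hh xy c /xy[t tn [/= s1 s2 s3 s4]]; exists t => //; split=> //= j jw.
by have [? ->] := s2 j jw; rewrite hh.
Qed.

Definition upd (h : nat -> nat) (i k : nat) : nat -> nat :=
  fun j => if j == i then k else h j.

Lemma word_tape_rcons out b p :
  word_tape gen_tm (rcons out b) p =
  if p == size out then bit b else word_tape gen_tm out p.
Proof.
by rewrite /word_tape map_rcons nth_rcons size_map; case: ltngtP => // /ltnW ?;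
  rewrite nth_default // size_map.
Qed.

Lemma leads_instr a h out i f b m o : a < size code ->
  nth (0, fun=> (0, Stay, None)) code a = (i, f) -> 0 < i < d.+2 ->
  f (copy w (h i)) = (b, m, o) ->
  leads 1 (a, h, out) (b, upd h i (move_head m (h i)), out ++ seq_of_opt o).
Proof.
move=> sa ci id fi c [/= s1 s2 s3 s4]; exists 1 => //=; rewrite /step s1 /=.
have -> : ((inord a : pcs) == ord_max) = false.
  by apply/eqP => /(congr1 val); rewrite /= inordK ?ltnS 1?ltnW //; lia.
have iw : working (inord i).
  by rewrite /working -!val_eqE /= !inordK; lia.
rewrite inordK 1?ltnW // ci /= ffunE.
have [-> ->] := s2 _ iw; rewrite inordK; last lia.
rewrite fi; split=> //=.
- move=> j jw; have [t1 t2] := s2 _ jw; rewrite !ffunE.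
  case/andP: (jw) => _ /negPf ->; rewrite /= /upd t2; split.
    by move=> p /=; case: eqP => [->|_]; rewrite ?t1 ?t2.
  by case: eqP => // ->.
- case: o {fi} => [x|] p; rewrite !ffunE eqxx /= s3 s4 ?cats0.
    by rewrite cats1 word_tape_rcons.
  by case: eqP => // ->.
- by rewrite !ffunE eqxx; case: o {fi} => [x|] /=; rewrite s4 ?cats0 // cats1 size_rcons.
Qed.

Lemma nth_copy k x v u : w = v ++ x :: u -> k = (size v).+1 -> copy w k = bit x.
Proof.
by move=> -> ->; rewrite /copy /= map_cat nth_cat size_map ltnn subnn.
Qed.

(** Induction on the program. The heads of levels from [l] on rest on the marker before and after it
    runs, so a body at level [l.+1] finds its heads ready while the head of tape [l] keeps the
    position of the enclosing loop. *)
Lemma leads_gen g : forall l a h out pre post,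
  code = pre ++ compile l a g ++ post -> size pre = a ->
  0 < l -> l + depth g <= d.+2 -> (forall j, l <= j -> h j = 0) ->
  leads (cost g (size w)) (a, h, out) (a + len g, h, out ++ eval g w).
Proof.
elim: g => [|x|g IHg h IHh|g IHg h IHh] l a hd out pre post cE sz l0 ld h0 /=.
- by rewrite addn0 cats0; apply: leads0.
- rewrite addn1.
  pose fx := fun _ : symbol => (a.+1, Stay, Some x).
  apply: (@leads_eqr _ _ _ (upd hd 1 (move_head Stay (hd 1)))).
    by move=> j; rewrite /upd /=; case: eqP => // ->.
  apply: (@leads_instr _ _ _ 1 fx _ Stay (Some x)) => //.
  + by rewrite cE size_cat /=; lia.
  + by rewrite cE nth_cat sz ltnn subnn.
- rewrite addnA catA; apply: leads_trans.
    apply: (IHg l _ _ _ pre (compile l (a + len g) h ++ post)) => //.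
      by rewrite cE /= -!catA.
    by apply: leq_trans ld; rewrite leq_add2l leq_maxl.
  apply: (IHh l _ _ _ (pre ++ compile l a g) post) => //.
  + by rewrite cE /= -!catA.
  + by rewrite size_cat size_compile sz.
  + by apply: leq_trans ld; rewrite leq_add2l leq_maxr.
move: cE => /=.
set b := a + 3 + _; set f0 := fun=> (a.+1, _, _).
set f1 := fun s : symbol => _; set f2 := fun s : symbol => _ => cE.
set cg := compile _ _ g in cE; set ch := compile _ _ h in cE.
have ltl : 0 < l < d.+2 by move: ld => /=; lia.
have szc : b + (len h).+1 <= size code.
  rewrite cE /= !size_cat /= !size_cat !size_rcons !size_compile /b; lia.
(* Layout of a loop: [a] leaves the marker, [a.+1] branches on the letter, [a.+2] runs back to the
   marker, and each body is followed by a copy of [f0], which advances the head and returns to the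
   test. *)
have n0 : nth (0, fun=> (0, Stay, None)) code a = (l, f0).
  by rewrite cE nth_cat sz ltnn subnn.
have n1 : nth (0, fun=> (0, Stay, None)) code a.+1 = (l, f1).
  by rewrite cE nth_cat sz ltnNge leqnSn subSn // subnn.
have n2 : nth (0, fun=> (0, Stay, None)) code a.+2 = (l, f2).
  by rewrite cE nth_cat sz -[a.+2]addn2 ltnNge leq_addr addKn.
have ng : nth (0, fun=> (0, Stay, None)) code (a + 3 + len g) = (l, f0).
  rewrite cE nth_cat sz -addnA ltnNge leq_addr addKn /= -catA nth_cat.
  by rewrite size_rcons size_compile ltnSn nth_rcons size_compile ltnn eqxx.
have nh : nth (0, fun=> (0, Stay, None)) code (b + len h) = (l, f0).
  rewrite cE nth_cat sz /b -!addnA ltnNge leq_addr addKn /= -catA nth_cat.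
  rewrite add0n size_rcons size_compile ltnNge leq_addr addKn nth_cat size_rcons.
  by rewrite size_compile ltnSn /= nth_rcons size_compile ltnn eqxx.
have hdl := h0 l (leqnn l).
have step1 p k f q m o : p < size code ->
    nth (0, fun=> (0, Stay, None)) code p = (l, f) ->
    f (copy w k) = (q, m, None) ->
    leads 1 (p, upd hd l k, o) (q, upd hd l (move_head m k), o).
  move=> pc pf fk.
  have := @leads_instr p (upd hd l k) o l f q m None pc pf ltl.
  rewrite {1 2}/upd eqxx /= cats0 => /(_ fk); apply: leads_eqr => j.
  by rewrite /upd eqxx; case: eqP.
have upd0 j : upd hd l 0 j = hd j by rewrite /upd; case: eqP => // ->.
have rewind k o : k <= size w ->
    leads k.+1 (a.+2, upd hd l k, o) (b + (len h).+1, hd, o).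
  elim: k => [|k IH] kw.
    by apply: leads_eqr upd0 _; apply: (step1 _ 0 f2 _ Stay) => //; lia.
  apply: (@leads_trans 1) (IH (ltnW kw)).
  apply: (step1 _ k.+1 f2 _ Left) => //; first lia.
  by rewrite /f2 /copy /= (nth_map false).
have h0' k j : l.+1 <= j -> upd hd l k j = 0.
  by move=> lj; rewrite /upd gtn_eqF // h0 // ltnW.
(* [v] has been scanned; the marker in cell 0 shifts the head to [(size v).+1]. Each letter costs a
   test, a body and an advance, whence the 2; at the blank the test turns back and [(size w).+1]
   rewinding steps follow. *)
have loop u v o : w = v ++ u ->
    leads (size u * (cost g (size w) + cost h (size w) + 2) + (size w).+2)
      (a.+1, upd hd l (size v).+1, o)
      (b + (len h).+1, hd,
       o ++ flatten [seq if x then eval g w else eval h w | x <- u]).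
  elim: u v o => [|x u IH] v o wE.
    rewrite cats0 mul0n; apply: (@leads_trans 1); last exact: rewind.
    rewrite wE cats0; apply: (step1 _ _ f1 _ Left) => //; first lia.
    by rewrite /f1 /copy /= nth_default // size_map wE cats0.
  rewrite /= catA mulSn -addnA.
  apply: leads_trans (IH (rcons v x) _ _); last by rewrite wE cat_rcons.
  rewrite addn2 size_rcons.
  apply: (@leads_trans 1 _ _
    (if x then a + 3 else b, upd hd l (size v).+1, o)); last first.
    apply: (@leads_leq ((if x then cost g (size w) else cost h (size w)) + 1)).
      by case: x {wE}; lia.
    apply: leads_trans; last first.
      apply: (step1 (if x then a + 3 + len g else b + len h) _ f0 _ Right) => //.
        by case: x {wE}; lia.
      by case: x {wE}.
    case: x wE => wE.
      apply: (IHg l.+1 (a + 3) _ _ (pre ++ [:: (l, f0); (l, f1); (l, f2)])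
        ((l, f0) :: rcons ch (l, f0) ++ post)) => //.
      + by rewrite cE /= -!catA /= cat_rcons.
      + by rewrite size_cat sz.
      + by apply: leq_trans ld; rewrite /= addnS addSn ltnS leq_add2l leq_maxl.
      + exact: h0'.
    apply: (IHh l.+1 b _ _
      (pre ++ [:: (l, f0), (l, f1), (l, f2) & rcons cg (l, f0)])
      ((l, f0) :: post)) => //.
    + by rewrite cE -!catA /= !cat_rcons.
    + by rewrite size_cat sz /= size_rcons size_compile /b; lia.
    + by apply: leq_trans ld; rewrite /= addnS addSn ltnS leq_add2l leq_maxr.
    + exact: h0'.
  apply: (step1 _ _ f1 _ Stay) => //; first lia.
  by rewrite (nth_copy wE erefl) /f1 /bit; case: x {wE}.
have -> : a + (3 + ((len g).+1 + (len h).+1)) = b + (len h).+1 by rewrite /b; lia.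
rewrite -addnA [_ + 3]addn3; set N := _ * _.
have -> : N + (size w).+3 = 1 + (N + (size w).+2) by lia.
apply: leads_trans (loop w [::] out erefl).
rewrite -/(move_head Right 0); apply: leads_eqr (fun j => erefl) _.
have := @leads_instr a hd out l f0 a.+1 Right None _ n0 ltl.
by rewrite hdl cats0; apply=> //; lia.
Qed.

Lemma copy_rcons v b p :
  copy (rcons v b) p = if p == (size v).+1 then bit b else copy v p.
Proof.
rewrite /copy map_rcons -rcons_cons nth_rcons /= size_map.
by case: ltngtP => // ?; rewrite nth_default //= size_map ltnW.
Qed.

Definition setup (s : option bool) (v : seq bool) (k i : nat) (c : conf) : Prop :=
  [/\ cfg_state c = inl s,
      forall j : 'I_d.+3, working j ->
        cfg_tape c j =1 copy v /\ cfg_head c j = k,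
      cfg_tape c ord0 =1 word_tape gen_tm w /\ cfg_head c ord0 = i &
      cfg_tape c ord_max =1 (fun=> None) /\ cfg_head c ord_max = 0].

Lemma working0 : working ord0 = false. Proof. by []. Qed.

Lemma working_max : working ord_max = false.
Proof. by rewrite /working eqxx andbF. Qed.

Lemma setup_start : setup (Some false) [::] 1 0 (step (init_config gen_tm w)).
Proof.
rewrite /step /=; split=> //=.
- move=> j jw; rewrite !ffunE jw; split=> //= -[|p] //=.
  by case/andP: jw => /negPf ->; rewrite /copy /= nth_nil.
- by rewrite !ffunE working0; split=> //= p; case: eqP => // ->.
- rewrite !ffunE working_max /=; split=> //= p; rewrite if_same //.
Qed.

Lemma setup_copy v b u c : w = v ++ b :: u ->
  setup (Some false) v (size v).+1 (size v) c ->
  setup (Some false) (rcons v b) (size v).+2 (size v).+1 (step c).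
Proof.
move=> wE [s1 s2 [s3 s4] [s5 s6]]; rewrite /step s1 /= ffunE s3 s4.
have -> : word_tape gen_tm w (size v) = bit b.
  by rewrite /word_tape wE map_cat nth_cat size_map ltnn subnn.
rewrite /bit; split=> //=.
- move=> j jw; have [t1 t2] := s2 j jw; rewrite !ffunE jw /= t2; split=> // p.
  by rewrite copy_rcons t1.
- rewrite !ffunE working0 eqxx /= s4; split=> // p.
  by case: eqP => [->|_]; rewrite ?s4 s3.
- rewrite !ffunE working_max /= s6; split=> // p.
  by rewrite !s5 if_same.
Qed.

Lemma setup_copied c : setup (Some false) w (size w).+1 (size w) c ->
  setup (Some true) w (size w) (size w) (step c).
Proof.
move=> [s1 s2 [s3 s4] [s5 s6]]; rewrite /step s1 /= ffunE s3 s4.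
have -> : word_tape gen_tm w (size w) = None.
  by rewrite /word_tape nth_default // size_map.
split=> //=.
- move=> j jw; have [t1 t2] := s2 j jw; rewrite !ffunE jw /= t2; split=> // p.
  by case: eqP => [->|_]; rewrite ?t2 t1.
- rewrite !ffunE working0 /= s4; split=> // p.
  by case: eqP => [->|_]; rewrite ?s4 s3.
- rewrite !ffunE working_max /= s6; split=> // p.
  by rewrite !s5 if_same.
Qed.

Lemma setup_rewind k c : k <= size w -> setup (Some true) w k (size w) c ->
  at_point (0, fun=> 0, [::]) (iter k.+1 step c).
Proof.
have iw : working (inord 1) by rewrite /working -!val_eqE /= !inordK.
elim: k c => [|k IH] c kw [s1 s2 [s3 s4] [s5 s6]].
  rewrite /= /step s1 /= ffunE; have [-> ->] := s2 _ iw.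
  split=> /=.
  - by congr inr; apply: val_inj; rewrite /= inordK.
  - move=> j jw; have [t1 t2] := s2 j jw; rewrite !ffunE t2; split=> // p.
    by case: eqP => [->|_]; rewrite ?t2 t1.
  - by move=> p; rewrite !ffunE /= !s5 if_same /word_tape nth_nil.
  - by rewrite !ffunE s6.
rewrite iterSr; apply: IH; first exact: ltnW.
rewrite /step s1 /= ffunE; have [-> ->] := s2 _ iw.
have -> : (copy w k.+1 == marker) = false by rewrite /copy /= (nth_map false).
split=> //=.
- move=> j jw; have [t1 t2] := s2 j jw; rewrite !ffunE jw /= t2; split=> // p.
  by case: eqP => [->|_]; rewrite ?t2 t1.
- rewrite !ffunE working0 /= s4; split=> // p.
  by case: eqP => [->|_]; rewrite ?s4 s3.
- rewrite !ffunE working_max /= s6; split=> // p.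
  by rewrite !s5 if_same.
Qed.

(** One step writes the markers, [size w] steps copy, one step turns at the blank, and [(size w).+1]
    steps rewind and enter the code. *)
Lemma setup_done :
  at_point (0, fun=> 0, [::])
    (iter (2 * size w + 3) step (init_config gen_tm w)).
Proof.
have copying u v c : w = v ++ u ->
    setup (Some false) v (size v).+1 (size v) c ->
    setup (Some false) w (size w).+1 (size w) (iter (size u) step c).
  elim: u v c => [|b u IH] v c wE; first by rewrite wE cats0.
  move=> /(setup_copy wE) /=; rewrite -iterS iterSr -(size_rcons v b).
  by apply: IH; rewrite cat_rcons.
have := setup_rewind (leqnn _) (setup_copied (copying w [::] _ erefl setup_start)).
by rewrite -!iterSr -iterD; have -> : 2 * size w + 3 = (size w).+3 + size w by lia.
Qed.

End Machine.

Lemma cost_poly g : exists p : {poly nat}, forall n, (p.[n])%R = cost g n.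
Proof.
elim: g => [|b|g [p pE] h [q qE]|g [p pE] h [q qE]] /=.
- by exists 0%R => n; rewrite horner0.
- by exists 1%R => n; rewrite hornerC.
- by exists (p + q)%R => n; rewrite hornerD pE qE.
exists ('X * (p + q + 2%:P) + 'X + 3%:P)%R => n.
by rewrite !(hornerD, hornerM, hornerX, hornerC) pE qE.
Qed.

Lemma poly_time_eval (f : seq bool -> seq bool) g :
  eval g =1 f -> poly_time f.
Proof.
move=> fE; have [p pE] := cost_poly g.
pose code := compile 1 0 g.
exists (gen_tm (depth g) code), ('X + 'X + 3%:P + p)%R => w.
have := @leads_gen (depth g) code w g 1 0 (fun=> 0) [::] [::] [::].
rewrite cats0 => /(_ erefl erefl isT (leqnSn _) (fun _ _ => erefl)).
move=> /(_ _ (setup_done _ _ w))[t tle [/= s1 s2 s3 s4]].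
exists (t + (2 * size w + 3)); split.
- by rewrite !(hornerD, hornerX, hornerC) pE addnC leq_add // mul2n -addnn.
- rewrite /run iterD /halted s1 /= -(size_compile 1 0 g) add0n.
  by apply/eqP/val_inj; rewrite /= inordK.
- by move=> q; rewrite /run iterD -fE; apply: s3.
Qed.

(** * Rows of linear systems *)

Section Rows.
Local Open Scope ring_scope.

Fixpoint dot (r : seq int) (X : nat -> int) : int :=
  if r is a :: r' then a * X 0%N + dot r' (fun i => X i.+1) else 0.

Lemma dotE r X : dot r X = \sum_(i < size r) r`_i * X i.
Proof. by elim: r X => [|a r IH] X; rewrite ?big_ord0 // big_ord_recl /= IH. Qed.

Lemma eq_dot r X Y : (forall i, (i < size r)%N -> X i = Y i) -> dot r X = dot r Y.
Proof. by move=> XY; rewrite !dotE; apply: eq_bigr => i _; rewrite XY. Qed.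

Lemma dot_cat r s X : dot (r ++ s) X = dot r X + dot s (fun i => X (size r + i)%N).
Proof. by elim: r X => [|a r IH] X /=; rewrite ?add0r // IH addrA. Qed.

Lemma dot_nseq0 k X : dot (nseq k 0) X = 0.
Proof. by elim: k X => //= k IH X; rewrite IH mul0r addr0. Qed.

Definition single (m i : nat) (c : int) : seq int :=
  mkseq (fun k => if k == i then c else 0) m.

Lemma size_single m i c : size (single m i c) = m.
Proof. exact: size_mkseq. Qed.

Lemma dot_single m i c X : (i < m)%N -> dot (single m i c) X = c * X i.
Proof.
move=> im; rewrite dotE size_mkseq (bigD1 (Ordinal im)) //= nth_mkseq // eqxx.
rewrite big1 ?addr0 // => j /eqP ji; rewrite nth_mkseq //.
by case: eqP => [ij|_]; [case: ji; apply: val_inj | rewrite mul0r].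
Qed.

(* The last entry of a row is the bound of the inequality. *)
Definition sys (n : nat) (rows : seq (seq int)) : linsys int n :=
  LinSys (\matrix_(i < size rows, j < n) (nth [::] rows i)`_j)
         (\col_(i < size rows) (nth [::] rows i)`_n).

(** The value -1 behind the last variable is the factor of the bound, so that every inequality takes
    the homogeneous form [dot r X <= 0]. *)
Definition ext (n : nat) (x : 'cV[int]_n) (j : nat) : int :=
  if insub j is Some i then x i 0 else -1.

Definition holds (rows : seq (seq int)) (X : nat -> int) : Prop :=
  forall r, r \in rows -> dot r X <= 0.

Lemma holds_cons r rows X : holds (r :: rows) X <-> dot r X <= 0 /\ holds rows X.
Proof.
split=> [H|[H1 H2] s]; last by rewrite inE => /predU1P[->|/H2].
by split=> [|s sr]; apply: H; rewrite inE ?eqxx // sr orbT.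
Qed.

Lemma holds_cat rows rows2 X : holds (rows ++ rows2) X <-> holds rows X /\ holds rows2 X.
Proof.
split=> [H|[H1 H2] r]; last by rewrite mem_cat => /orP[/H1|/H2].
by split=> r rr; apply: H; rewrite mem_cat rr ?orbT.
Qed.

Lemma sat_sys n rows (x : 'cV[int]_n) : all (fun r => size r == n.+1) rows ->
  sat (sys n rows) x <-> holds rows (ext x).
Proof.
move=> /all_nthP-/(_ [::]) sz.
have dE i : (i < size rows)%N ->
    dot (nth [::] rows i) (ext x) = \sum_(j < n) (nth [::] rows i)`_j * x j 0 -
      (nth [::] rows i)`_n.
  move=> /sz /eqP si; rewrite dotE si big_ord_recr /= {2}/ext insubF ?ltnn // mulrN1.
  congr (_ - _); apply: eq_bigr => j _; rewrite /ext insubT // => jn.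
  by congr (_ * x _ _); apply: val_inj.
split=> [H r /(nthP [::])[i ir <-]|H i].
  have := H (Ordinal ir); rewrite dE // subr_le0 !mxE /=.
  by congr (_ <= _); apply: eq_bigr => j _; rewrite !mxE.
have := H _ (mem_nth [::] (ltn_ord i)); rewrite dE // subr_le0 !mxE /=.
by congr (_ <= _); apply: eq_bigr => j _; rewrite !mxE.
Qed.

Definition encode_ints (s : seq int) : seq bool := flatten (map encode_int s).

Lemma encode_ints_cat s t : encode_ints (s ++ t) = encode_ints s ++ encode_ints t.
Proof. by rewrite /encode_ints map_cat flatten_cat. Qed.

(** As each row ends with its bound, row boundaries leave no trace in the code: only the
    concatenated list of entries has to be printed. *)
Lemma encode_sys n rows : all (fun r => size r == n.+1) rows ->
  encode_linsys (sys n rows) = encode_dim (size rows) ++ encode_ints (flatten rows).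
Proof.
have mkE (T : Type) (f : nat -> T) m : [seq f (val i) | i <- enum 'I_m] = mkseq f m.
  by rewrite map_comp val_enum_ord.
move=> sz; rewrite /encode_linsys /=; congr (_ ++ _).
pose f i := encode_ints (nth [::] rows i).
transitivity (flatten (mkseq f (size rows))).
  rewrite -mkE; congr flatten; apply: eq_map => i.
  have si : size (nth [::] rows i) = n.+1.
    by apply/eqP; apply: (allP sz); rewrite mem_nth.
  pose r := nth [::] rows i; have rE : r = mkseq (nth 0 r) n ++ [:: r`_n].
    by rewrite -[LHS](mkseq_nth 0 r) si /mkseq -addn1 iotaD map_cat.
  rewrite /f -/r [in RHS]rE encode_ints_cat; congr (_ ++ _).
    rewrite /encode_ints -mkE -[in RHS]map_comp.
    by congr flatten; apply: eq_map => j; rewrite /= mxE.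
  by rewrite mxE /encode_ints /= cats0.
rewrite /mkseq map_comp -/(mkseq _ _) mkseq_nth.
elim: rows {sz f} => //= r rows IH; rewrite encode_ints_cat IH.
by [].
Qed.

(* The row of zeros makes the concatenation of the rows periodic. *)
Definition band (core : seq int) (s J W : nat) : seq (seq int) :=
  rcons [seq nseq (s * j) 0 ++ core ++ nseq (W - (s * j + size core)) 0 | j <- iota 0 J]
        (nseq W 0).

Lemma size_band core s J W : size (band core s J W) = J.+1.
Proof. by rewrite size_rcons size_map size_iota. Qed.

Lemma all_band core s J W : (s * J + size core <= W + s)%N ->
  all (fun r => size r == W) (band core s J W).
Proof.
move=> H; rewrite all_rcons size_nseq eqxx /= all_map; apply/allP => j /=.
rewrite mem_iota add0n => /andP[_ jJ]; rewrite !size_cat !size_nseq addnA subnKC //.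
by have : (s * j.+1 <= s * J)%N; [rewrite leq_mul2l jJ orbT | rewrite mulnS; lia].
Qed.

(** Between the cores of rows [j] and [j.+1] there are W - (s j + |core|) + s (j + 1) = W + s -
    |core| = [tl] zeros, whatever [j] is. The final row of zeros completes the gap after the last
    core and leaves [pd] zeros over. *)
Lemma flatten_band core s J W tl pd : (s * J + size core <= W + s)%N ->
  (size core + tl = W + s)%N -> (s * J + pd = W)%N ->
  flatten (band core s J W) = flatten (nseq J (core ++ nseq tl 0)) ++ nseq pd 0.
Proof.
move=> H1 H2 H3; rewrite /band -cats1 flatten_cat /= cats0.
rewrite -{2}H3 nseqD catA; congr (_ ++ _).
elim: J H1 {pd H3} => [|J IH] H1; first by rewrite muln0.
rewrite -addn1 iotaD nseqD map_cat !flatten_cat add0n /= !cats0.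
rewrite -IH -?catA; last by move: H1; rewrite mulnS; lia.
do 3 congr (_ ++ _); rewrite -nseqD; congr nseq; move: H1; rewrite addn1 mulnS; lia.
Qed.

Lemma holds_band core s J W X :
  holds (band core s J W) X <->
  forall j, (j < J)%N -> dot core (fun i => X (s * j + i)%N) <= 0.
Proof.
have E j : dot (nseq (s * j) 0 ++ core ++ nseq (W - (s * j + size core)) 0) X =
    dot core (fun i => X (s * j + i)%N).
  by rewrite !dot_cat !dot_nseq0 addr0 add0r size_nseq.
split=> [H j jJ|H r].
  rewrite -E; apply: H; rewrite mem_rcons inE; apply/orP; right.
  by apply/mapP; exists j; rewrite ?mem_iota.
rewrite mem_rcons inE => /predU1P[->|/mapP[j]]; first by rewrite dot_nseq0.
by rewrite mem_iota => /andP[_ jJ] ->; rewrite E H.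
Qed.

Definition sign (b : bool) : int := if b then 1 else -1.

Lemma dot_sign_eq (t : seq bool) Y : (forall i, (i < size t)%N -> Y i = (nth false t i)%:Z) ->
  dot (map sign t) Y = (count id t)%:Z.
Proof.
elim: t Y => //= b t IH Y H; rewrite IH => [|i it]; last exact: (H i.+1).
by rewrite (H 0%N) // PoszD; case: b {H}.
Qed.

Lemma dot_sign_le (t u : seq bool) Y : size t = size u ->
  (forall i, (i < size u)%N -> Y i = (nth false u i)%:Z) ->
  dot (map sign t) Y <= (count id t)%:Z - (t != u)%:Z.
Proof.
elim: t u Y => [|b t IH] [|d u] Y //= [tu] H.
have := IH u (fun i => Y i.+1) tu (fun i iu => H i.+1 iu).
by rewrite eqseq_cons (H 0%N) // PoszD; case: b d {H} => [] []; case: (t != u) => /=; lia.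
Qed.

End Rows.

#[global] Arguments dot : simpl never.
#[global] Arguments single : simpl never.
#[local] Arguments nseq : simpl never.

(** * Boolean functions as systems of integer inequalities *)

Section BooleanFunction.
Local Open Scope ring_scope.
Variables (I O : nat) (phi : I.-tuple bool -> option (O.-tuple bool)).

(* On 0/1 inputs, [dot (map sign t) Y] is at most [count id t], with equality
   only at [t], so all other inputs leave a slack of 1. *)
Definition output_rows (t : I.-tuple bool) : seq (seq int * seq int * int) :=
  let c := rcons (map sign t) 0 in
  let k := (count id t)%:Z in
  if phi t is Some o then
    [seq (c, single O.+1 j (- sign (nth false o j)), k - (nth false o j)%:Z) | j <- iota 0 O]
  else [:: (c, nseq O.+1 0, k - 1)].

Definition bound_rows (m m' : nat) : seq (seq int * seq int * int) :=
  flatten [seq [:: (single m.+1 i 1, nseq m'.+1 0, 1); (single m.+1 i (-1), nseq m'.+1 0, 0)]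
          | i <- iota 0 m].

(** Both windows carry the counter as an extra last entry, at index [I] before and [O] after the
    step. The first two rows decrease it by 1, the next two groups bound the bits, the last group is
    the truth table. *)
Definition table : seq (seq int * seq int * int) :=
  [:: (single I.+1 I (-1), single O.+1 O 1, -1); (single I.+1 I 1, single O.+1 O (-1), 1)] ++
  bound_rows I O ++ [seq (r.1.2, r.1.1, r.2) | r <- bound_rows O I] ++
  flatten [seq output_rows t | t <- enum {: I.-tuple bool}].

Lemma size_table r : r \in table -> size r.1.1 = I.+1 /\ size r.1.2 = O.+1.
Proof.
rewrite !mem_cat => /or4P[|/flatten_mapP[i _]|/mapP[q /flatten_mapP[i _]]|/flatten_mapP[t _]].
- by rewrite !inE => /orP[]/eqP ->; rewrite !size_single.
- by rewrite !inE => /orP[]/eqP ->; rewrite size_single size_nseq.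
- by rewrite !inE => /orP[]/eqP -> ->; rewrite size_single size_nseq.
rewrite /output_rows; case: (phi t) => [o|].
  by move=> /mapP[j _ ->]; rewrite size_rcons size_map size_tuple size_single.
by rewrite inE => /eqP ->; rewrite size_rcons size_map size_tuple size_nseq.
Qed.

Definition table_holds (Y Y' : nat -> int) : Prop :=
  forall r, r \in table -> dot r.1.1 Y + dot r.1.2 Y' <= r.2.

(** Integers between 0 and 1 are bits, so the input is some tuple [t]. On it, row [j] of
    [output_rows t] reads [- sign o_j * Y' j <= - o_j], which leaves one bit value; if [phi t] is
    undefined, its row is violated. Rows of other tuples have slack 1, enough for either value of
    the output bit. *)
Lemma tableP Y Y' : table_holds Y Y' <->
  exists t o, [/\ phi t = Some o, forall i, (i < I)%N -> Y i = (nth false t i)%:Z,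
    forall j, (j < O)%N -> Y' j = (nth false o j)%:Z & Y' O = Y I - 1].
Proof.
have dotc (t : I.-tuple bool) : dot (rcons (map sign t) 0) Y = dot (map sign t) Y.
  by rewrite -cats1 dot_cat /dot /= mul0r !addr0.
have mem_out t r : r \in output_rows t -> r \in table.
  move=> rt; rewrite !mem_cat; apply/or4P/Or44/flatten_mapP.
  by exists t => //; rewrite mem_enum.
split=> [H|[t [o [to Yt Yo Yz]]]]; last first.
  move=> r; rewrite !mem_cat => /or4P[|/flatten_mapP[i]|/mapP[q /flatten_mapP[i]]|].
  - by rewrite !inE => /orP[]/eqP -> /=; rewrite !dot_single // Yz; lia.
  - rewrite mem_iota add0n => /andP[_ iI].
    rewrite !inE => /orP[]/eqP ->; rewrite /= dot_nseq0 addr0 dot_single 1?ltnW // Yt //;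
    by case: nth.
  - rewrite mem_iota add0n => /andP[_ iO].
    rewrite !inE => /orP[]/eqP -> ->; rewrite /= dot_nseq0 add0r dot_single 1?ltnW // Yo //;
    by case: nth.
  move=> /flatten_mapP[u _].
  have uY : dot (map sign u) Y <= (count id u)%:Z - (u != t)%:Z.
    by apply: dot_sign_le; rewrite ?size_tuple.
  rewrite /output_rows; case: (eqVneq u t) uY => [->|ut] uY.
    rewrite to => /mapP[j]; rewrite mem_iota add0n => /andP[_ jO] -> /=.
    rewrite dotc dot_single 1?ltnW // Yo //; move: uY; case: nth => /=; lia.
  case: (phi u) => [p|].
    move=> /mapP[j]; rewrite mem_iota add0n => /andP[_ jO] -> /=.
    rewrite dotc dot_single 1?ltnW // Yo //.
    by move: uY; case: (nth _ p); case: (nth _ o) => /=; lia.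
  rewrite inE => /eqP -> /=; rewrite dotc dot_nseq0; move: uY => /=; lia.
have mem_bound m m' i : (i < m)%N ->
    (single m.+1 i 1, nseq m'.+1 0, 1) \in bound_rows m m' /\
    (single m.+1 i (-1), nseq m'.+1 0, 0) \in bound_rows m m'.
  move=> im; split; apply/flatten_mapP; exists i; rewrite ?mem_iota //;
    by rewrite !inE eqxx ?orbT.
have bit_int (x : int) : x <= 1 -> - x <= 0 -> x = (x == 1)%:Z.
  by case: eqP; lia.
have Yt i : (i < I)%N -> Y i = (Y i == 1)%:Z.
  move=> iI; have [m1 m2] := mem_bound I O i iI.
  apply: bit_int.
    have /H : (single I.+1 i 1, nseq O.+1 0, 1) \in table by rewrite !mem_cat m1 !orbT.
    by rewrite /= dot_nseq0 dot_single 1?ltnW // mul1r addr0.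
  have /H : (single I.+1 i (-1), nseq O.+1 0, 0) \in table by rewrite !mem_cat m2 !orbT.
  by rewrite /= dot_nseq0 dot_single 1?ltnW // mulN1r addr0.
have Yo j : (j < O)%N -> Y' j = (Y' j == 1)%:Z.
  move=> jO; have [m1 m2] := mem_bound O I j jO; apply: bit_int.
    have /H : (nseq I.+1 0, single O.+1 j 1, 1) \in table.
      rewrite !mem_cat; apply/or4P/Or43/mapP.
      by exists (single O.+1 j 1, nseq I.+1 0, 1).
    by rewrite /= dot_nseq0 dot_single 1?ltnW // mul1r add0r.
  have /H : (nseq I.+1 0, single O.+1 j (-1), 0) \in table.
    rewrite !mem_cat; apply/or4P/Or43/mapP.
    by exists (single O.+1 j (-1), nseq I.+1 0, 0).
  by rewrite /= dot_nseq0 dot_single 1?ltnW // mulN1r add0r.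
have [t tE] : exists t : I.-tuple bool,
    forall i, (i < I)%N -> nth false t i = (Y i == 1).
  exists [tuple Y i == 1 | i < I] => i iI.
  by rewrite -[i]/(val (Ordinal iI)) -tnth_nth tnth_mktuple.
have tc : dot (map sign t) Y = (count id t)%:Z.
  by apply: dot_sign_eq => i; rewrite size_tuple => iI; rewrite tE // -Yt.
have Ht r : r \in output_rows t -> dot r.1.1 Y + dot r.1.2 Y' <= r.2.
  by move=> /mem_out/H.
case to : (phi t) Ht => [o|]; rewrite /output_rows to => Ht; last first.
  have := Ht _ (mem_head _ _); rewrite /= dotc tc dot_nseq0; lia.
exists t, o; split=> // [i iI|j jO|].
- by rewrite tE // -Yt.
- have := Ht (rcons (map sign t) 0, single O.+1 j (- sign (nth false o j)),
    (count id t)%:Z - (nth false o j)%:Z).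
  have jm : j \in iota 0 O by rewrite mem_iota.
  move=> /(_ (map_f _ jm)) /=; rewrite dotc tc dot_single 1?ltnW //.
  by rewrite (Yo j jO); case: (Y' j == 1); case: nth => /=; lia.
have z1 : (single I.+1 I (-1), single O.+1 O 1, -1) \in table.
  by rewrite !inE eqxx.
have z2 : (single I.+1 I 1, single O.+1 O (-1), 1) \in table.
  by rewrite !inE eqxx !orbT.
by have := H _ z1; have := H _ z2; rewrite /= !dot_single //; lia.
Qed.

End BooleanFunction.

(** * Initial states and transitions *)

Section Precondition.
Local Open Scope ring_scope.

Definition rails (s : seq bool) : seq bool := flatten [seq [:: b; ~~ b] | b <- s].

Lemma rails_cat s t : rails (s ++ t) = rails s ++ rails t.
Proof. by rewrite /rails map_cat flatten_cat. Qed.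

Lemma size_rails s : size (rails s) = (2 * size s)%N.
Proof. by elim: s => //= b s ->; lia. Qed.

Lemma nth_rails s j : (j < 2 * size s)%N ->
  nth false (rails s) j = odd j (+) nth false s j./2.
Proof.
elim: s j => // b s IH [|[|j]] //=; rewrite negbK mulnS => js.
exact: IH.
Qed.

Definition ints_of (s : seq bool) : seq int := [seq b%:Z | b : bool <- s].

(* Nonnegativity, equal sums of consecutive pairs of rails, and vanishing of the
   rails that are off: fixing the values one by one would put bounds on the rows
   and make the bands aperiodic. *)
Definition pre_rows (s : seq bool) : seq (seq int) :=
  let B := (2 * size s)%N in
  band [:: -1] 1 B.+1 B.+2 ++
  (band [:: 1; 1; -1; -1] 2 (size s).-1 B.+2 ++
   (band [:: -1; -1; 1; 1] 2 (size s).-1 B.+2 ++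
    [:: [:: 1; 1] ++ nseq B.-1 0 ++ [:: 1];
        [:: -1; -1] ++ nseq B.-1 0 ++ [:: -1];
        ints_of (rails (map negb s)) ++ [:: 1; 0]])).

Lemma size_pre_rows s : (0 < size s)%N -> size (pre_rows s) = (4 * size s + 5)%N.
Proof. by move=> s0; rewrite /pre_rows !size_cat !size_band /=; lia. Qed.

Lemma all_pre_rows s : (0 < size s)%N ->
  all (fun r => size r == (2 * size s).+2) (pre_rows s).
Proof.
move=> s0; rewrite /pre_rows !all_cat !all_band /=; try lia.
rewrite !size_cat !size_nseq /= size_map size_rails size_map; lia.
Qed.

(** The last row bounds the sum of the off rails and of the counter by 0; as all variables are
    nonnegative, each of these vanishes. The first pair adds up to 1 and the bands carry this to all
    pairs, so the partners of the off rails equal 1. *)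
Lemma pre_rowsP s X : (0 < size s)%N -> X (2 * size s).+1 = -1 ->
  holds (pre_rows s) X <->
  (forall j, (j < 2 * size s)%N -> X j = (nth false (rails s) j)%:Z) /\
  X (2 * size s)%N = 0.
Proof.
move=> s0 XW; rewrite /pre_rows !holds_cat !holds_band !holds_cons.
set B := (2 * size s)%N in XW *.
have rowE a b c : dot ([:: a; b] ++ nseq B.-1 0 ++ [:: c]) X = a * X 0%N + b * X 1%N - c.
  rewrite !dot_cat dot_nseq0 size_nseq /dot /= !addr0 add0r.
  rewrite -mulrN1 -XW; congr (_ + _ * X _); rewrite /B; lia.
have compE : dot (ints_of (rails (map negb s)) ++ [:: 1; 0]) X =
    \sum_(j < B) (nth false (rails (map negb s)) j)%:Z * X j + X B.
  rewrite dot_cat dotE size_map size_rails size_map -/B /dot /= mul1r mul0r !addr0 addn0.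
  congr (_ + _); apply: eq_bigr => j _; rewrite (nth_map false) //.
  by rewrite size_rails size_map.
have ncomp j : (j < B)%N ->
    nth false (rails (map negb s)) j = ~~ nth false (rails s) j.
  move=> jB; rewrite !nth_rails ?size_map // (nth_map false) ?addbN //.
  by rewrite /B in jB; lia.
have even_odd i : (i < size s)%N ->
    nth false (rails s) (2 * i) = nth false s i /\
    nth false (rails s) (2 * i).+1 = ~~ nth false s i.
  move=> iS; rewrite !nth_rails /= ?mul2n; try lia.
  by rewrite odd_double uphalf_double doubleK.
rewrite !rowE compE; split=> [[nn [up [dn [r1 [r2 [r3 _]]]]]]|[Xv XB]].
  have X0 j : (j <= B)%N -> 0 <= X j.
    by move=> jB; have := nn j jB; rewrite /dot /= addn0 mul1n addr0 mulN1r oppr_le0.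
  have sum0 : 0 <= \sum_(j < B) (nth false (rails (map negb s)) j)%:Z * X j.
    by apply: sumr_ge0 => j _; apply: mulr_ge0 => //; apply/X0/ltnW.
  (* The counter has coefficient 1 in the last row, so its start value needs no row of its own. *)
  have XB : X B = 0 by have := X0 B (leqnn _); lia.
  have off j : (j < B)%N -> nth false (rails s) j = false -> X j = 0.
    move=> jB vj.
    have : \sum_(j < B) (nth false (rails (map negb s)) j)%:Z * X j = 0.
      by apply/eqP; rewrite eq_le sum0 andbT; lia.
    have nn' (i : 'I_B) : true -> 0 <= (nth false (rails (map negb s)) i)%:Z * X i.
      by move=> _; apply: mulr_ge0 => //; apply/X0/ltnW.
    move=> /(psumr_eq0P nn')/(_ (Ordinal jB) isT) /=.
    by rewrite ncomp // vj mul1r.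
  have pair i : (i < size s)%N -> X (2 * i)%N + X (2 * i).+1 = 1.
    elim: i => [|i IH] iS; first by rewrite muln0; lia.
    have iS' : (i < (size s).-1)%N by lia.
    have := up i iS'; have := dn i iS'; have := IH (ltnW iS).
    rewrite /dot /= !addn0 !addnS !addn0 mulnS !addSn add0n; lia.
  split=> // j jB; have js : (j./2 < size s)%N by rewrite /B in jB; lia.
  have [E1 E2] := even_odd _ js; have := pair _ js.
  have := off (2 * j./2)%N; have := off (2 * j./2).+1; rewrite E1 E2.
  have b1 : (2 * j./2 < B)%N by rewrite /B; lia.
  have b2 : ((2 * j./2).+1 < B)%N by rewrite /B; lia.
  have jE : j = (2 * j./2)%N \/ j = (2 * j./2).+1 by lia.
  case: (nth false s j./2) E1 E2 => E1 E2 o2 o1 p; case: jE => ->; rewrite ?E1 ?E2 /=.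
  - by move: p; rewrite o2 // addr0.
  - exact: o2.
  - exact: o1.
  - by move: p; rewrite o1 // add0r.
have pair i : (i < size s)%N -> X (2 * i)%N + X (2 * i).+1 = 1.
  move=> iS; have [E1 E2] := even_odd _ iS.
  by rewrite !Xv ?E1 ?E2; [case: (nth _ s i) | rewrite /B; lia | rewrite /B; lia].
have X0 j : (j <= B)%N -> 0 <= X j.
  by rewrite leq_eqVlt => /predU1P[->|/Xv ->] //; rewrite XB.
split=> [j jB|]; first by rewrite /dot /= addn0 mul1n addr0 mulN1r oppr_le0 X0.
split=> [j jS|].
  have := pair j; have := pair j.+1.
  rewrite /dot /= !addn0 !addnS !addn0 mulnS !addSn add0n; lia.
split=> [j jS|].
  have := pair j; have := pair j.+1.
  rewrite /dot /= !addn0 !addnS !addn0 mulnS !addSn add0n; lia.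
have := pair 0%N s0; rewrite muln0 XB addr0 => p0.
split; [lia|split; [lia|split=> //]].
rewrite big1 // => j _; rewrite ncomp // Xv //.
by case: (nth _ _ _).
Qed.

End Precondition.

(** * The update: a shift by one letter and a truth table on a window *)

Section Update.
Local Open Scope ring_scope.
Variables (K L G : nat).
Variable phi : (K + K + G).-tuple bool -> option ((K + G).-tuple bool).

Definition bits_dim : nat := (K + K + L + G)%N.
Local Notation n := bits_dim.+1.

(** In row [j] the two nonzero entries fall on the columns [j + K] of the old state and [n + j],
    which is column [j] of the new one; [c] = 1 and [c] = -1 give both halves of an equality. *)
Definition shift_core (c : int) : seq int :=
  nseq K 0 ++ [:: - c] ++ nseq (K + L + G) 0 ++ [:: c].

(** The input window consists of the first two letters, then, beyond the [L] bits of the other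
    letters, control and counter. The output window consists of the last letter, control and
    counter, behind [K + L] shifted bits. *)
Definition table_row (r : seq int * seq int * int) : seq int :=
  take (K + K) r.1.1 ++ nseq L 0 ++ drop (K + K) r.1.1 ++ nseq (K + L) 0 ++
  r.1.2 ++ [:: r.2].

Definition upd_rows : seq (seq int) :=
  band (shift_core 1) 1 (K + L) (n + n).+1 ++
  (band (shift_core (-1)) 1 (K + L) (n + n).+1 ++ map table_row (table phi)).

Lemma size_shift_core c : size (shift_core c) = n.+1.
Proof. by rewrite /shift_core !size_cat !size_nseq /= /bits_dim; lia. Qed.

Lemma size_upd_rows : size upd_rows = (2 * (K + L).+1 + size (table phi))%N.
Proof.
rewrite /upd_rows; move: (table phi) => T.
by rewrite !size_cat !size_band size_map mul2n -addnn addnA.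
Qed.

Lemma all_upd_rows : all (fun r => size r == (n + n).+1) upd_rows.
Proof.
rewrite /upd_rows !all_cat !all_band ?size_shift_core /bits_dim; try lia.
rewrite !andTb all_map; apply/allP => r /size_table[s1 s2] /=.
by rewrite /table_row !size_cat !size_nseq size_take size_drop s1 s2 /=; case: ltnP; lia.
Qed.

Lemma upd_rowsP X : X (n + n)%N = -1 ->
  holds upd_rows X <->
  (forall j, (j < K + L)%N -> X (n + j)%N = X (j + K)%N) /\
  table_holds phi (fun i => if (i < K + K)%N then X i else X (i + L)%N)
    (fun i => X (n + (K + L) + i)%N).
Proof.
move=> XW; rewrite /upd_rows !holds_cat !holds_band.
have coreE c j : dot (shift_core c) (fun i => X (1 * j + i)%N) =
    c * (X (n + j)%N - X (j + K)%N).
  rewrite /shift_core !dot_cat !dot_nseq0 !size_nseq /dot /= !addr0 add0r !add0r.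
  rewrite mul1n !addn0 mulrBr addrC mulNr; congr (c * X _ - c * X _).
  by rewrite /bits_dim; lia.
have rowE r : r \in table phi -> dot (table_row r) X =
    dot r.1.1 (fun i => if (i < K + K)%N then X i else X (i + L)%N) +
    dot r.1.2 (fun i => X (n + (K + L) + i)%N) - r.2.
  move=> /size_table[s1 s2].
  have st : size (take (K + K) r.1.1) = (K + K)%N by rewrite size_take s1; case: ltnP; lia.
  have sd : size (drop (K + K) r.1.1) = G.+1 by rewrite size_drop s1; lia.
  rewrite -[in RHS](cat_take_drop (K + K) r.1.1) /table_row !dot_cat !dot_nseq0.
  rewrite !size_nseq st sd s2 !add0r -!addrA; congr (_ + (_ + (_ + _))).
  - by apply: eq_dot => i; rewrite st => ->.
  - apply: eq_dot => i _; rewrite ltnNge leq_addr /=; congr X; lia.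
  - by apply: eq_dot => i _; congr X; rewrite /bits_dim; lia.
  - rewrite /dot /= addr0 -mulrN1 -XW; congr (_ * X _); rewrite /bits_dim; lia.
split=> [[up [dn tb]]|[sh tb]].
  split=> [j jJ|r rt].
    by have := up j jJ; have := dn j jJ; rewrite !coreE; lia.
  by have := tb _ (map_f _ rt); rewrite rowE // subr_le0.
split=> [j jJ|]; first by rewrite coreE sh // subrr mulr0.
split=> [j jJ|_ /mapP[r rt ->]]; first by rewrite coreE sh // subrr mulr0.
by rewrite rowE // subr_le0 tb.
Qed.

End Update.

(** * Simulation of a Turing machine by a queue *)

Section Sweep.
Variable M : tm.

Local Notation tape := 'I_(tm_tapes M).+1.

Definition reading : finType := {ffun tape -> tm_symbol M}.
Definition cell : finType := {ffun tape -> tm_symbol M * bool}.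
(* [None] is the end mark of the queue. *)
Definition letter : finType := option cell.

(* State ([None] during the first sweep, which only puts the heads on cell 0),
   symbols read by the current step, symbols read by the next step as far as
   they are known, heads that enter from the left, start of a sweep. *)
Definition control : finType :=
  (option (tm_state M) * reading * reading * {ffun tape -> bool} * bool)%type.

Definition rule (q : tm_state M) (r : reading) :
    tm_state M * {ffun tape -> tm_symbol M * direction} :=
  if tm_halting q then (q, [ffun i => (r i, Stay)]) else tm_delta q r.

Definition is_left (d : direction) : bool := if d is Left then true else false.
Definition is_right (d : direction) : bool := if d is Right then true else false.

(** The rule is local: a head can reach a cell only from itself or a neighbour. [entering] remembers
    the cell just rewritten, [next] looks at the following one, and [first] implements the left move
    that stays on cell 0. *)
Definition new_head (d : direction) (here first entering next : bool) : bool :=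
  if here then match d with Left => first | Stay => true | Right => false end
  else entering || next && is_left d.

Lemma new_headE d h p :
  new_head d (h == p) (p == 0) ((h.+1 == p) && is_right d) (h == p.+1) =
  (move_head d h == p).
Proof.
rewrite /new_head; case: (h =P p) => [->|/eqP hp]; case: d => /=.
- by case: p => [|p] //; rewrite [RHS]ltn_eqF.
- by rewrite eqxx.
- by rewrite gtn_eqF.
- by rewrite andbF andbT; case: h hp => //= hp; rewrite eq_sym (negPf hp).
- by rewrite !andbF (negPf hp).
- by rewrite andbT andbF orbF.
Qed.

(** The second letter [a2] is inspected, not consumed: a head on it that moves left must be put into
    [a]. The state changes only at the end mark, when the reading for the next step is complete. *)
Definition queue_rule (a a2 : letter) (s : control) : letter * control :=
  let: (q, r, r2, carry, first) := s in
  match a, q with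
  | None, _ =>
    (None, (Some (if q is Some q' then (rule q' r).1 else tm_start M),
            r2, r2, [ffun=> false], true))
  | Some x, None =>
    (Some [ffun i => ((x i).1, first)],
     (None, r, if first then [ffun i => (x i).1] else r2, carry, false))
  | Some x, Some q =>
    let act := (rule q r).2 in
    let hd i := new_head (act i).2 (x i).2 first (carry i)
                  (if a2 is Some y then (y i).2 else false) in
    let x' := [ffun i => (if (x i).2 then (act i).1 else (x i).1, hd i)] in
    (Some x',
     (Some q, r, [ffun i => if hd i then (x' i).1 else r2 i],
      [ffun i => (x i).2 && is_right (act i).2], false))
  end.

Definition queue_step (x : seq letter * control) : seq letter * control :=
  if x.1 is a :: u then
    let y := queue_rule a (head None u) x.2 in (rcons u y.1, y.2)
  else x.

Definition accepts (s : control) : bool :=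
  if s.1.1.1.1 is Some q then tm_halting q && tm_accepting q else false.

Definition cell_of (c : config M) (p : nat) : cell :=
  [ffun i => (cfg_tape c i p, cfg_head c i == p)].

Definition reading_of (c : config M) : reading :=
  [ffun i => cfg_tape c i (cfg_head c i)].

Definition act_of (c : config M) := (rule (cfg_state c) (reading_of c)).2.

Lemma step_state c : cfg_state (step c) = (rule (cfg_state c) (reading_of c)).1.
Proof. by rewrite /step /rule; case: ifP. Qed.

Lemma step_head c i :
  cfg_head (step c) i = move_head (act_of c i).2 (cfg_head c i).
Proof. by rewrite /step /act_of /rule; case: ifP; rewrite ?ffunE. Qed.

Lemma step_tape c i p :
  cfg_tape (step c) i p =
  if cfg_head c i == p then (act_of c i).1 else cfg_tape c i p.
Proof.
rewrite /step /act_of /rule eq_sym; case: ifP => //= _; rewrite !ffunE /=.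
by case: eqP => // ->.
Qed.

Variable m : nat.

Definition mid_queue (old new : nat -> cell) (p : nat) : seq letter :=
  drop p (mkseq (Some \o old) m) ++ None :: take p (mkseq (Some \o new) m).

Lemma size_mid_queue old new p : p <= m -> size (mid_queue old new p) = m.+1.
Proof.
move=> pm; rewrite size_cat size_drop size_mkseq /= size_takel ?size_mkseq //.
by rewrite addnS subnK.
Qed.

Lemma queue_step_mid old new p s : p < m ->
  queue_step (mid_queue old new p, s) =
  let y := queue_rule (Some (old p))
             (if p.+1 < m then Some (old p.+1) else None) s in
  (drop p.+1 (mkseq (Some \o old) m) ++
     None :: rcons (take p (mkseq (Some \o new) m)) y.1, y.2).
Proof.
move=> pm; rewrite /mid_queue (drop_nth None) ?size_mkseq // nth_mkseq //=.
rewrite /queue_step /= rcons_cat /=; set h := head _ _.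
suff -> : h = if p.+1 < m then Some (old p.+1) else None by [].
rewrite /h; case: ltnP => pm1; first by rewrite (drop_nth None) ?size_mkseq // nth_mkseq.
by rewrite drop_oversize // size_mkseq.
Qed.

Lemma mid_queueS old new p : p < m ->
  mid_queue old new p.+1 =
  drop p.+1 (mkseq (Some \o old) m) ++
     None :: rcons (take p (mkseq (Some \o new) m)) (Some (new p)).
Proof.
by move=> pm; rewrite /mid_queue (take_nth None) ?size_mkseq // nth_mkseq.
Qed.

Lemma queue_step_end old new s :
  queue_step (mid_queue old new m, s) =
  (mid_queue new new 0, (queue_rule None (head None (mkseq (Some \o new) m)) s).2).
Proof.
rewrite /mid_queue drop_oversize ?size_mkseq // take_oversize ?size_mkseq //.
rewrite drop0 take0 /= cats1 /queue_step /=.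
by case: s => [[[[q r] r2] carry] first] /=.
Qed.

(** The second reading starts each sweep as a copy of the first; its entries are replaced as the
    sweep passes the new head positions, the others remain those of [c]. *)
Definition mid (c : config M) (p : nat) : seq letter * control :=
  (mid_queue (cell_of c) (cell_of (step c)) p,
   (Some (cfg_state c), reading_of c,
    [ffun i => if cfg_head (step c) i < p then reading_of (step c) i
               else reading_of c i],
    [ffun i => ((cfg_head c i).+1 == p) && is_right (act_of c i).2],
    p == 0)).

Lemma mid_step c p : (forall i, cfg_head c i < m) -> p < m ->
  queue_step (mid c p) = mid c p.+1.
Proof.
move=> hm pm; rewrite /mid queue_step_mid // mid_queueS //.
have hdE i : new_head (act_of c i).2 (cell_of c p i).2 (p == 0)
    ([ffun i => ((cfg_head c i).+1 == p) && is_right (act_of c i).2] i)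
    (if (if p.+1 < m then Some (cell_of c p.+1) else None) is Some y
     then (y i).2 else false) = (cfg_head (step c) i == p).
  rewrite step_head -new_headE !ffunE; congr new_head.
  case: ltnP => pm1; first by rewrite ffunE.
  (* After the last cell comes the end mark, which counts as having no heads; rightly so, because no
     head is on cell [m]. *)
  by rewrite ltn_eqF // (leq_trans (hm i)).
rewrite /queue_rule -/(act_of c) /=; set x := [ffun i => _].
have -> : x = cell_of (step c) p.
  by apply/ffunP => i; rewrite ffunE hdE !ffunE step_tape.
congr (_, (_, _, _, _, _)); apply/ffunP => i; last by rewrite !ffunE eqSS.
by rewrite ffunE hdE !ffunE ltnS [in RHS]leq_eqVlt; case: eqP => [<-|].
Qed.

Lemma mid_end c : (forall i, cfg_head (step c) i < m) ->
  queue_step (mid c m) = mid (step c) 0.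
Proof.
move=> hm; rewrite /mid queue_step_end /= step_state; congr (_, (_, _, _, _, _)).
- by rewrite /mid_queue !take0.
- by apply/ffunP => i; rewrite !ffunE hm.
- by apply/ffunP => i; rewrite !ffunE hm.

Qed.

Lemma mid_iter c p : (forall i, cfg_head c i < m) -> p <= m ->
  iter p queue_step (mid c 0) = mid c p.
Proof.
by move=> hm; elim: p => //= p IH pm; rewrite IH ?mid_step // ltnW.
Qed.

Variable w : seq bool.

Definition blank_reading : reading := [ffun=> tm_blank M].

(** No head is marked, so a start letter depends on its symbol alone and not on its position; this
    keeps the start word printable letter by letter. *)
Definition start_cell (a : tm_symbol M) : cell :=
  [ffun i => (if i == ord0 then a else tm_blank M, false)].

Definition start_control : control :=
  (None, blank_reading, blank_reading, [ffun=> false], true).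

Definition start (p : nat) : seq letter * control :=
  (mid_queue (fun p => start_cell (word_tape M w p))
     (cell_of (init_config M w)) p,
   (None, blank_reading,
    if p == 0 then blank_reading else reading_of (init_config M w),
    [ffun=> false], p == 0)).

Lemma start_iter p : p <= m -> iter p queue_step (start 0) = start p.
Proof.
elim: p => //= p IH pm; rewrite IH ?(ltnW pm) // /start queue_step_mid //.
rewrite mid_queueS //=; congr (_ ++ _ :: rcons _ (Some _), (_, _, _, _, _)).
  by apply/ffunP => i; rewrite !ffunE /=; congr (_, _); rewrite eq_sym.
by case: p {IH pm} => //=; apply/ffunP => i; rewrite !ffunE.
Qed.

Lemma start_end : 0 < m -> queue_step (start m) = mid (init_config M w) 0.
Proof.
move=> m0; rewrite /start queue_step_end /mid gtn_eqF //=.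
congr (_, (_, _, _, _, _)); first by rewrite /mid_queue !take0.
  by apply/ffunP => i; rewrite !ffunE.
Qed.

Hypothesis space : forall t i, cfg_head (run M w t) i < m.

(** A sweep takes [m.+1] iterations, one for each cell and one for the end mark; the extra sweep in
    [t.+1] is the one that places the heads. *)
Lemma queue_run t p : p <= m ->
  iter (p + t.+1 * m.+1) queue_step (start 0) = mid (run M w t) p.
Proof.
move=> pm; rewrite iterD -(mid_iter (space t)) //; congr iter => {p pm}.
have m0 : 0 < m by apply: leq_ltn_trans (space 0 ord0).
elim: t => [|t IH]; first by rewrite mul1n /= start_iter // start_end.
by rewrite mulSn iterD IH iterS (mid_iter (space t)) // (mid_end (space t.+1)).
Qed.

Lemma queue_accepts :
  (exists t, accepts (iter t queue_step (start 0)).2) <->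
  (exists t, accepted (run M w t)).
Proof.
split=> [[t]|[t acc]]; last first.
  by exists (0 + t.+1 * m.+1); rewrite queue_run.
(* Every time lies inside some sweep: in sweep 0 the state is still [None] and nothing is accepted,
   in sweep [k.+1] the control shows the state of the configuration at time [k]. *)
have pm : t %% m.+1 <= m by rewrite -ltnS ltn_mod.
rewrite (divn_eq t m.+1) addnC; case: (t %/ m.+1) => [|k].
  by rewrite addn0 start_iter.
by rewrite queue_run //; exists k.
Qed.

End Sweep.

(** Halted configurations are stationary, so acceptance at any time agrees with the verdict at the
    halting time supplied by [decides]. *)
Lemma decides_accepted M L w : decides M L ->
  L w <-> exists t, accepted (run M w t).
Proof.
have stuck t k : halted (run M w t) -> run M w (k + t) = run M w t.
  by move=> ht; elim: k => //= k; rewrite /run /= -/(run _ _ _) => ->;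
    rewrite /step -/(halted _) ht.
move=> /(_ w)[t ht tL]; split=> [/tL|[k ak]]; first by exists t.
apply/tL; case: (leqP k t) => [kt|/ltnW tk].
  by rewrite -(subnK kt) stuck //; case/andP: ak.
by move: ak; rewrite -(subnK tk) stuck.
Qed.

(** * Ranking functions of deterministic 0/1 loops *)

Section Polyhedral.
Local Open Scope ring_scope.
Variable n : nat.
Implicit Types (h : 'cV[int]_n -> rat) (I J : 'cV[int]_n -> Prop).

Definition affine_fun h := exists lam lam0, h =1 affine lam lam0.

Lemma affine_const c : affine_fun (fun=> c).
Proof. by exists 0, c => x; rewrite /affine mul0mx mxE add0r. Qed.

Lemma affine_coord j : affine_fun (fun x => (x j 0)%:~R).
Proof.
exists (delta_mx 0 j), 0 => x; rewrite /affine -rowE !mxE addr0 //.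
Qed.

Lemma affineD h1 h2 :
  affine_fun h1 -> affine_fun h2 -> affine_fun (fun x => h1 x + h2 x).
Proof.
move=> [a [a0 E1]] [b [b0 E2]]; exists (a + b), (a0 + b0) => x.
by rewrite E1 E2 /affine mulmxDl [in RHS]mxE addrACA.
Qed.

Lemma affineZ c h : affine_fun h -> affine_fun (fun x => c * h x).
Proof.
move=> [a [a0 E1]]; exists (c *: a), (c * a0) => x.
by rewrite E1 /affine -scalemxAl [in RHS]mxE mulrDr.
Qed.

Lemma affineB h1 h2 :
  affine_fun h1 -> affine_fun h2 -> affine_fun (fun x => h1 x - h2 x).
Proof.
move=> h1P /(affineZ (-1)) h2P.
have [a [a0 E]] := affineD h1P h2P.
by exists a, a0 => x; rewrite -E mulN1r.
Qed.

Lemma affine_sum (T : Type) (s : seq T) (P : pred T) (h : T -> 'cV[int]_n -> rat) :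
  (forall i, affine_fun (h i)) ->
  affine_fun (fun x => \sum_(i <- s | P i) h i x).
Proof.
move=> hP; elim: s => [|i s IH].
  have [a [a0 E]] := affine_const 0.
  by exists a, a0 => x; rewrite big_nil -(E x).
have hs : affine_fun (fun x => (if P i then h i x else 0) + \sum_(j <- s | P j) h j x).
  by apply: affineD => //; case: (P i); [apply: hP | apply: affine_const].
have [a [a0 E]] := hs.
by exists a, a0 => x; rewrite -E big_cons; case: ifP; rewrite ?add0r.
Qed.

Lemma polyhedral_ext I J : (forall x, I x <-> J x) -> polyhedral J -> polyhedral I.
Proof. by move=> IJ [S SP]; exists S => x; rewrite IJ. Qed.

Lemma polyhedral_ge0 h : affine_fun h -> polyhedral (fun x => 0 <= h x).
Proof.
move=> [a [a0 E]]; exists (@LinSys _ _ 1 (- a) (const_mx a0)) => x.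
rewrite E /affine /sat; split=> [H i|/(_ 0)] /=.
  by rewrite ord1 mulNmx !mxE lerNl -subr_ge0 opprK; move: H; rewrite !mxE addrC.
by rewrite mulNmx !mxE lerNl -subr_ge0 opprK addrC.
Qed.

Lemma polyhedral_true : polyhedral (fun _ : 'cV[int]_n => True).
Proof. by exists (@LinSys _ _ 0 0 0) => x; split=> // _ [[]]. Qed.

Lemma polyhedral_and I J :
  polyhedral I -> polyhedral J -> polyhedral (fun x => I x /\ J x).
Proof.
move=> [S SP] [T TP].
exists (LinSys (col_mx (ls_lhs S) (ls_lhs T)) (col_mx (ls_rhs S) (ls_rhs T))) => x.
rewrite SP TP /sat /= mul_col_mx; split=> [[Sx Tx] i|ST].
  by rewrite !mxE; case: (split i) => k; [apply: Sx | apply: Tx].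
split=> k; first by have := ST (lshift _ k); rewrite !col_mxEu.
by have := ST (rshift _ k); rewrite !col_mxEd.
Qed.

Lemma polyhedral_forall (T : finType) (I : T -> 'cV[int]_n -> Prop) :
  (forall i, polyhedral (I i)) -> polyhedral (fun x => forall i, I i x).
Proof.
move=> IP; suff : forall s : seq T, polyhedral (fun x => forall i, i \in s -> I i x).
  move=> /(_ (enum T)); apply: polyhedral_ext => x; split=> [H i _|H i]; first exact: H.
  by apply: H; rewrite mem_enum.
elim=> [|i s IH]; first by apply: polyhedral_ext polyhedral_true => x; split.
apply: polyhedral_ext (polyhedral_and (IP i) IH) => x; split=> [H|[H1 H2] j].
  by split=> [|j js]; apply: H; rewrite inE ?eqxx ?js ?orbT.
by rewrite inE => /predU1P[->|/H2].
Qed.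

End Polyhedral.

(** * Existence of a ranking function versus termination of the single run *)

Section Ranking.
Local Open Scope ring_scope.
Variables (l : loop) (z : 'I_(loop_dim l)) (Q : Type) (F : Q -> Q).
Variables (stop : pred Q) (ok : Q -> Prop) (q0 : Q) (e : Q -> 'I_(loop_dim l) -> bool).
Local Notation n := (loop_dim l).

Definition point_of (q : Q) (k : int) : state l :=
  \col_j if j == z then k else (e q j)%:Z.

Hypothesis ok0 : ok q0.
Hypothesis okF : forall q, ok q -> ok (F q).
Hypothesis e_inj : forall q r, ok q -> ok r ->
  (forall j, j != z -> e q j = e r j) -> q = r.
Hypothesis initialE : forall x : state l, initial x <-> x = point_of q0 0.
Hypothesis transitionE : forall q k (y : state l), ok q ->
  transition (point_of q k) y <-> ~~ stop q /\ y = point_of (F q) (k - 1).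

Local Notation q_ t := (iter t F q0).
Let x_ t : state l := point_of (q_ t) (- t%:Z).

Lemma ok_iter t : ok (q_ t). Proof. by elim: t => //= t /okF. Qed.

Lemma transition_iter t y : transition (x_ t) y <-> ~~ stop (q_ t) /\ y = x_ t.+1.
Proof.
rewrite /x_ transitionE ?iterS; last exact: ok_iter.
by have -> : - t%:Z - 1 = - t.+1%:Z by lia.
Qed.

(** On 0/1 points this is the Hamming distance to [u], the coordinate [z] left out, written as an
    affine function. *)
Definition mismatch (u : 'I_n -> bool) (x : 'cV[int]_n) : rat :=
  \sum_(j | j != z) if u j then 1 - (x j 0)%:~R else (x j 0)%:~R.

Lemma affine_mismatch u : affine_fun (mismatch u).
Proof.
apply: affine_sum => j; case: (u j); last exact: affine_coord.
by apply: affineB; [apply: affine_const | apply: affine_coord].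
Qed.

Lemma mismatch_eq0 u q k : (forall j, j != z -> u j = e q j) ->
  mismatch u (point_of q k) = 0.
Proof.
move=> uq; apply: big1 => j jz; rewrite mxE (negPf jz) uq //.
by case: (e q j).
Qed.

Lemma mismatch_ge1 u q k : ~~ [forall (j | j != z), u j == e q j] ->
  1 <= mismatch u (point_of q k).
Proof.
rewrite negb_forall => /existsP[j]; rewrite negb_imply => /andP[jz uj].
rewrite /mismatch (bigD1 j) //= -[1]addr0 lerD //.
  by rewrite mxE (negPf jz); move: uj; case: (u j) (e q j) => [] [].
apply: sumr_ge0 => i /andP[iz _]; rewrite mxE (negPf iz).
by case: (u i) (e q i) => [] [].
Qed.

(** Any inductive invariant contains the whole run, along which the ranking function drops by at
    least 1 per step; with more than rho(x_0) steps it would be negative at the source of a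
    transition. *)
Lemma ranking_stop : has_ranking_with_invariant l -> exists t, stop (q_ t).
Proof.
move=> [I [[I0 IS] _ [lam [lam0 rk]]]].
set rho := affine lam lam0 in rk.
pose K := Num.bound (rho (x_ 0)).
case: (boolP [exists t : 'I_K.+1, stop (q_ t)]) => [/existsP[t]|]; first by exists t.
move=> /existsPn nostop.
have go t : (t <= K)%N -> I (x_ t) /\ rho (x_ t) <= rho (x_ 0) - t%:R.
  elim: t => [|t IH] tK.
    by split; [apply/I0/initialE | rewrite subr0].
  have [It rt] := IH (ltnW tK).
  have tr : transition (x_ t) (x_ t.+1).
    by apply/transition_iter; split=> //; apply: (nostop (Ordinal (leqW tK))).
  split; first exact: IS tr It.
  have [_] := rk _ _ (conj tr It); rewrite -natr1; lra.
have [IK rK] := go K (leqnn _).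
have trK : transition (x_ K) (x_ K.+1).
  by apply/transition_iter; split=> //; apply: (nostop ord_max).
have [r0 _] := rk _ _ (conj trK IK).
have := archi_boundP (le_trans r0 (le_trans rK _)); rewrite -/K.
move=> /(_ (rho (x_ 0))); rewrite lerBlDr lerDl ler0n => /(_ isT); lra.
Qed.

Lemma stop_ranking : (exists t, stop (q_ t)) -> has_ranking_with_invariant l.
Proof.
move=> /ex_minnP[T stopT minT].
(* A repetition before the first stopping time [T] could be cut out of the run, which would then
   stop earlier. *)
have q_inj s t : (s < t)%N -> (t <= T)%N -> q_ s <> q_ t.
  move=> st tT E; have := minT ((T - t) + s)%N.
  rewrite iterD E -iterD subnK // => /(_ stopT); lia.
(* This says that |z + t| is at most [T] times the distance to the vector at time [t]. At that
   vector it forces z = -t; at the other points of the run the distance is at least 1 and two times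
   differ by at most [T], so it holds. *)
pose near (t : 'I_T.+1) (x : state l) : Prop :=
  0 <= (x z 0)%:~R + t%:R + T%:R * mismatch (e (q_ t)) x /\
  0 <= T%:R * mismatch (e (q_ t)) x - (x z 0)%:~R - t%:R.
pose box (j : 'I_n) (x : state l) : Prop := j != z ->
  0 <= (x j 0)%:~R :> rat /\ 0 <= 1 - (x j 0)%:~R :> rat.
pose seen (u : {ffun 'I_n -> bool}) :=
  [exists t : 'I_T.+1, [forall (j | j != z), u j == e (q_ t) j]].
pose cut (u : {ffun 'I_n -> bool}) (x : state l) : Prop := ~~ seen u -> 0 <= mismatch u x - 1.
pose I (x : state l) := (forall j, box j x) /\ (forall u, cut u x) /\ forall t, near t x.
have IP x : I x <-> exists2 t, (t <= T)%N & x = x_ t.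
  split=> [[xb [xc xn]]|[t tT ->]].
    have x01 j : j != z -> (x j 0 == 0) || (x j 0 == 1).
      by move=> /xb[]; rewrite ler0z subr_ge0 lerz1; lia.
    pose u := [ffun j => x j 0 == 1].
    have xu j : j != z -> x j 0 = (u j)%:Z.
      by move=> /x01; rewrite ffunE => /orP[]/eqP ->.
    have u0 (v : 'I_n -> bool) : (forall j, j != z -> v j = u j) -> mismatch v x = 0.
      move=> uv; apply: big1 => j jz; rewrite uv // xu //.
      by case: (u j).
    (* Otherwise the cut of [u] would require [u] to be at distance at least 1 from itself. *)
    have : seen u.
      by apply: contraT => /xc; rewrite u0.
    move=> /existsP[t /forall_inP ut]; exists t; first by rewrite -ltnS.
    have := xn t; rewrite /near u0; last by move=> j /ut/eqP.
    rewrite mulr0 addr0 add0r => -[z1 z2].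
    have zE : x z 0 = - t%:Z.
      by apply/eqP; rewrite -(eqr_int rat) rmorphN /=; apply/eqP; lra.
    apply/colP => j; rewrite mxE; case: eqP => [->|/eqP jz] //.
    by rewrite xu // (eqP (ut j jz)).
  split; [|split].
  - move=> j jz; rewrite mxE (negPf jz); by case: (e _ _).
  - move=> u nu; rewrite subr_ge0; apply: mismatch_ge1.
    apply: contra nu => ut; apply/existsP; exists (Ordinal (tT : (t < T.+1)%N)).
    exact: ut.
  - move=> s; rewrite /near mxE eqxx.
    case: (boolP [forall (j | j != z), e (q_ s) j == e (q_ t) j]) => [/forall_inP E|].
      (* Equal 0/1 parts come from equal times, by injectivity of [e] and absence of repetitions;
         this is what makes the value of [z] unambiguous. *)
      have {}E : q_ s = q_ t by apply: e_inj (ok_iter _) (ok_iter _) _ => j /E/eqP.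
      have -> : val s = t.
        have sT : (s <= T)%N by rewrite -ltnS.
        by case: (ltngtP s t) => // H; [case: (q_inj _ _ H tT) | case: (q_inj _ _ H sT)].
      rewrite mismatch_eq0 //.
      by rewrite mulr0 rmorphN /=; split; lra.
    move=> /mismatch_ge1 => /(_ (- t%:Z)) mm; rewrite rmorphN /=.
    have tT' : t%:R <= T%:R :> rat by rewrite ler_nat.
    have sT' : s%:R <= T%:R :> rat by rewrite ler_nat -ltnS.
    have s0 : 0 <= s%:R :> rat by rewrite ler0n.
    have t0 : 0 <= t%:R :> rat by rewrite ler0n.
    have T0 : 0 <= T%:R :> rat by rewrite ler0n.
    have {}mm : T%:R <= T%:R * mismatch (e (q_ s)) (x_ t) by rewrite ler_peMr.
    by split; rewrite -/(x_ t); lra.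
exists I; split.
- split=> [x /initialE ->|x y xy /IP[t tT xE]]; apply/IP; first by exists 0.
  move: xy; rewrite xE => /transition_iter[nt ->]; exists t.+1 => //.
  (* At time [T] there is no transition, so the successor still belongs to the finite run. *)
  rewrite ltn_neqAle tT andbT; apply: contra nt => /eqP ->; exact: stopT.
- apply: polyhedral_and.
    apply: polyhedral_forall => j; rewrite /box; case: eqP => _.
      by apply: polyhedral_ext (polyhedral_true _) => x; split.
    apply: (@polyhedral_ext _ _ (fun x => 0 <= (x j 0)%:~R :> rat /\
      0 <= 1 - (x j 0)%:~R :> rat)) => [x|]; first by split=> [H|H _] //; apply: H.
    apply: polyhedral_and; apply: polyhedral_ge0; first exact: affine_coord.
    by apply: affineB; [apply: affine_const | apply: affine_coord].
  apply: polyhedral_and.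
    apply: polyhedral_forall => u; rewrite /cut; case: (seen u) => /=.
      by apply: polyhedral_ext (polyhedral_true _) => x; split.
    apply: (@polyhedral_ext _ _ (fun x => 0 <= mismatch u x - 1)) => [x|].
      by split=> [H|H _] //; apply: H.
    apply: polyhedral_ge0; apply: affineB; first exact: affine_mismatch.
    exact: affine_const.
  apply: polyhedral_forall => t; apply: polyhedral_and; apply: polyhedral_ge0.
    apply: affineD; last by apply/affineZ/affine_mismatch.
    by apply: affineD; [apply: affine_coord | apply: affine_const].
  apply: affineB; last exact: affine_const.
  by apply: affineB; [apply/affineZ/affine_mismatch | apply: affine_coord].
- exists (delta_mx 0 z), T%:R => x y [xy /IP[t tT xE]].
  move: xy; rewrite xE => /transition_iter[nt ->].
  rewrite /affine -!rowE !mxE eqxx !rmorphN /=.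
  have -> : (t.+1%:Z)%:~R = t%:R + 1 :> rat by rewrite natr1.
  rewrite -[(t%:Z)%:~R]/(t%:R : rat).
  have : t%:R <= T%:R :> rat by rewrite ler_nat.
  by split; lra.
Qed.

End Ranking.

(** * The reduction *)

Section Generators.
Variables (c e : nat).

Definition emit (s : seq bool) : gen := foldr (fun b => Cat (Out b)) Skip s.

Lemma eval_emit s w : eval (emit s) w = s.
Proof. by elim: s => //= b s ->. Qed.

Definition emit_all (gs : seq gen) : gen := foldr Cat Skip gs.

Lemma eval_all gs w : eval (emit_all gs) w = flatten [seq eval g w | g <- gs].
Proof. by elim: gs => //= g gs ->. Qed.

Lemma flatten_cons (T : Type) (s : seq T) ss : flatten (s :: ss) = s ++ flatten ss.
Proof. by []. Qed.

Lemma flatten_nseqM (T : Type) a b (s : seq T) :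
  flatten (nseq a (flatten (nseq b s))) = flatten (nseq (a * b) s).
Proof. by elim: a => //= a IH; rewrite mulSn nseqD flatten_cat IH. Qed.

Lemma flatten_const (s t : seq bool) :
  flatten [seq if b then t else t | b : bool <- s] = flatten (nseq (size s) t).
Proof. by elim: s => //= b s ->; case: b. Qed.

Fixpoint power (k : nat) (g : gen) : gen :=
  if k is k'.+1 then
    let h := power k' g in Cat (Rep h h) (emit_all (nseq c h))
  else g.

Lemma eval_power k g w :
  eval (power k g) w = flatten (nseq ((size w + c) ^ k) (eval g w)).
Proof.
elim: k => [|k IH] /=; first by rewrite cats0.
rewrite eval_all map_nseq expnS -flatten_nseqM -IH nseqD flatten_cat.
by rewrite flatten_const.
Qed.

(** The cells of the input and (|w| + c)^e further ones, the power being a bound on the space used.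
    All dimensions of the instance are of the form [a * width w + b] with constants that do not
    depend on [w], which is the number of copies that [repeat] prints. *)
Definition width (w : seq bool) : nat := size w + (size w + c) ^ e.

Definition repeat (a b : nat) (g : gen) : gen :=
  let h := emit_all (nseq a g) in
  Cat (Cat (Rep h h) (power e h)) (emit_all (nseq b g)).

Lemma eval_repeat a b g w :
  eval (repeat a b g) w = flatten (nseq (a * width w + b) (eval g w)).
Proof.
rewrite /= eval_power !eval_all !map_nseq nseqD flatten_cat mulnC -flatten_nseqM.
by rewrite flatten_const nseqD flatten_cat.
Qed.

Definition ints (s : seq int) : gen := emit (encode_ints s).

Lemma eval_ints s w : eval (ints s) w = encode_ints s.
Proof. exact: eval_emit. Qed.

Definition zeros (a b : nat) : gen := repeat a b (ints [:: 0%R]).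

Lemma encode_nseq k (s : seq int) :
  encode_ints (flatten (nseq k s)) = flatten (nseq k (encode_ints s)).
Proof. by elim: k => //= k IH; rewrite encode_ints_cat IH. Qed.

Lemma eval_zeros a b w k : k = a * width w + b ->
  eval (zeros a b) w = encode_ints (nseq k 0%R).
Proof.
move=> ->; rewrite eval_repeat eval_ints -encode_nseq; congr encode_ints.
by elim: (_ + _) => //= k' ->.
Qed.

Definition dim_gen (a b : nat) : gen := Cat (repeat a b (Out true)) (Out false).

Lemma eval_dim a b w k : k = a * width w + b ->
  eval (dim_gen a b) w = encode_dim k.
Proof.
move=> ->; rewrite /encode_dim -cats1 /dim_gen.
rewrite -[LHS]/(eval (repeat a b (Out true)) w ++ [:: false]) eval_repeat.
by congr (_ ++ _); elim: (_ + _) => //= k' ->.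
Qed.

(** The three pairs of constants give, in terms of [width], the number of cores, the length of the
    gap after each core and the length of the final block of zeros. *)
Definition band_gen (core : gen) (aJ bJ az bz ap bp : nat) : gen :=
  Cat (repeat aJ bJ (Cat core (zeros az bz))) (zeros ap bp).

Lemma eval_band coreg core s J W aJ bJ az bz ap bp w :
  eval coreg w = encode_ints core -> J = aJ * width w + bJ ->
  s * J + size core <= W + s ->
  size core + (az * width w + bz) = W + s -> s * J + (ap * width w + bp) = W ->
  eval (band_gen coreg aJ bJ az bz ap bp) w = encode_ints (flatten (band core s J W)).
Proof.
move=> cE JE H1 H2 H3; rewrite (flatten_band H1 H2 H3) /band_gen.
rewrite -[LHS]/(eval (repeat _ _ _) w ++ eval (zeros ap bp) w).
rewrite eval_repeat -JE -[eval (Cat _ _) w]/(eval coreg w ++ eval (zeros az bz) w).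
by rewrite !(eval_zeros erefl) cE encode_ints_cat encode_nseq encode_ints_cat.
Qed.

End Generators.

(** * Dual-rail codes of finite types *)

Section Code.
Variable T : finType.

Definition one_hot (x : T) : seq bool := [seq x == y | y <- enum T].

Lemma size_one_hot x : size (one_hot x) = #|T|.
Proof. by rewrite size_map -cardE. Qed.

Definition code (x : T) : seq bool := rails (one_hot x).

Lemma size_code x : size (code x) = 2 * #|T|.
Proof. by rewrite size_rails size_one_hot. Qed.

Lemma code_inj : injective code.
Proof.
move=> x y; rewrite /code => E.
have {}E : one_hot x = one_hot y.
  move: E; rewrite /rails; elim: (one_hot x) (one_hot y) => [|a s IH] [|b t] //=.
  by case=> -> _ /IH ->.
have /(_ y (mem_enum _ y)) := (eq_in_map (eq_op x) (eq_op y) (enum T)).2 E.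
by rewrite eqxx => /eqP.
Qed.

End Code.

Lemma ext_lt n (x : 'cV[int]_n) (j : 'I_n) : ext x j = x j 0%R.
Proof. by rewrite /ext valK. Qed.

Lemma ext_n n (x : 'cV[int]_n) : ext x n = (-1)%R.
Proof. by rewrite /ext insubF // ltnn. Qed.

Lemma ext_inj n (x y : 'cV[int]_n) : (forall j, j < n -> ext x j = ext y j) -> x = y.
Proof. by move=> H; apply/colP => j; rewrite -!ext_lt H. Qed.

Lemma ext_col_mxl n (x y : 'cV[int]_n) j : j < n -> ext (col_mx x y) j = ext x j.
Proof.
move=> jn; rewrite -[j]/(val (Ordinal jn)) [RHS]ext_lt.
by rewrite -[val _]/(val (lshift n (Ordinal jn))) ext_lt col_mxEu.
Qed.

Lemma ext_col_mxr n (x y : 'cV[int]_n) j : j <= n -> ext (col_mx x y) (n + j) = ext y j.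
Proof.
rewrite leq_eqVlt => /predU1P[->|jn]; first by rewrite !ext_n.
rewrite -[n + j]/(val (rshift n (Ordinal jn))) ext_lt col_mxEd.
by rewrite -[j in RHS]/(val (Ordinal jn)) ext_lt.
Qed.

(** * The loop attached to a machine and an input *)

Section Reduction.
Variables (M : tm) (c e : nat).

Local Notation letter := (letter M).
Local Notation control := (control M).
Local Notation k := #|letter|.
Local Notation g := #|control|.
Local Notation K := (2 * k).
Local Notation G := (2 * g).
Local Notation queue_rule := (@queue_rule M).
Local Notation queue_step := (@queue_step M).
Local Notation accepts := (@accepts M).
Local Notation start := (@start M).
Local Notation queue := (seq letter * control)%type.

(** An accepting control gets no output, and neither does a tuple that encodes no window; the truth
    table then excludes the input altogether, which is how the loop stops. *)
Definition step_bits (t : (K + K + G).-tuple bool) : option ((K + G).-tuple bool) :=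
  if [pick x : letter * letter * control |
        tval t == code x.1.1 ++ code x.1.2 ++ code x.2] is Some x then
    if accepts x.2 then None else
    let y := queue_rule x.1.1 x.1.2 x.2 in insub (code y.1 ++ code y.2)
  else None.

Lemma step_bits_code (t : (K + K + G).-tuple bool) a a2 s o :
  tval t = code a ++ code a2 ++ code s ->
  step_bits t = Some o <->
  ~~ accepts s /\ tval o = code (queue_rule a a2 s).1 ++ code (queue_rule a a2 s).2.
Proof.
move=> tE; rewrite /step_bits; case: pickP => [[[a' a2'] s'] /= /eqP|/(_ (a, a2, s))].
  rewrite tE => /eqP; rewrite eqseq_cat ?size_code // eqseq_cat ?size_code //.
  case/and3P => /eqP/code_inj <- /eqP/code_inj <- /eqP/code_inj <-.
  case: (accepts s); first by split=> // -[].
  split=> [|[_ oE]]; last by rewrite -oE valK.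
  by case: insubP => // o' _ <- [<-].
by rewrite /= tE eqxx.
Qed.

Definition raw_bits (q : queue) : seq bool :=
  flatten [seq one_hot a | a <- q.1] ++ one_hot q.2.

Definition queue_bits (q : queue) : seq bool := rails (raw_bits q).

Lemma size_raw_bits q : size (raw_bits q) = size q.1 * k + g.
Proof.
rewrite size_cat size_one_hot; congr (_ + _).
by elim: q.1 => //= a u IH; rewrite size_cat size_one_hot IH.
Qed.

Definition codes (u : seq letter) : seq bool := flatten [seq code a | a <- u].

Lemma size_codes u : size (codes u) = K * size u.
Proof.
by elim: u => [|a u IH] /=; rewrite ?muln0 // size_cat size_code IH mulnS.
Qed.

Lemma bitsE u s : queue_bits (u, s) = codes u ++ code s.
Proof.
rewrite /queue_bits rails_cat; congr (_ ++ _) => /=.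
by elim: u => //= a u IH; rewrite rails_cat IH.
Qed.

Variable w : seq bool.

Local Notation R := (width c e w).
Local Notation P := ((size w + c) ^ e).
Local Notation L := (K * R).
Local Notation B := (bits_dim K L G).
Local Notation n := B.+1.

(** With [R.+1] cells and the end mark there are [R.+2] letters: two fill the window, and the other
    [R] account for the [L] bits outside it. *)
Definition start_queue : queue := start R.+1 w 0.

Definition reduction : loop :=
  @Loop n (sys n (pre_rows (raw_bits start_queue))) (sys n [::])
    (sys (n + n) (upd_rows L step_bits)).

Definition well_sized (q : queue) : Prop := size q.1 = R.+2.

Local Notation point := (@point_of reduction ord_max queue
  (fun q j => nth false (queue_bits q) j)).

Lemma size_bits q : well_sized q -> size (queue_bits q) = B.
Proof.
by move=> qR; rewrite size_rails size_raw_bits qR /bits_dim; lia.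
Qed.

Lemma ext_point q x j : j < B -> ext (point q x) j = (nth false (queue_bits q) j)%:Z%R.
Proof.
move=> jB; rewrite -[j]/(val (Ordinal (ltnW jB : j < n))) ext_lt mxE.
by rewrite -val_eqE /= ltn_eqF.
Qed.

Lemma ext_point_max q x : ext (point q x) B = x.
Proof. by rewrite -[B]/(val (ord_max : 'I_n)) ext_lt mxE eqxx. Qed.

Lemma point_ext q x (y : state reduction) :
  (forall j, j < B -> ext y j = (nth false (queue_bits q) j)%:Z%R) -> ext y B = x ->
  y = point q x.
Proof.
move=> yq yx; apply: ext_inj => j; rewrite ltnS leq_eqVlt => /predU1P[->|jB].
  by rewrite yx ext_point_max.
by rewrite yq // ext_point.
Qed.

Lemma start_well_sized : well_sized start_queue.
Proof. exact: size_mid_queue. Qed.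

Lemma step_well_sized q : well_sized q -> well_sized (queue_step q).
Proof.
by case: q => [[|a u] s] //=; rewrite /well_sized /queue_step /= size_rcons.
Qed.

Lemma letter_gt0 : 0 < k. Proof. by apply/card_gt0P; exists None. Qed.

Lemma size_start_bits : 2 * size (raw_bits start_queue) = B.
Proof. by rewrite -size_rails size_bits //; apply: start_well_sized. Qed.

Lemma reduction_initial (x : state reduction) :
  initial x <-> x = point start_queue 0%R.
Proof.
have k0 := letter_gt0; have B0 := size_start_bits.
have s0 : 0 < size (raw_bits start_queue).
  by rewrite size_raw_bits start_well_sized; lia.
have szs := all_pre_rows s0; have preP := pre_rowsP s0; rewrite B0 in szs preP.
rewrite /initial (sat_sys x szs) preP; last exact: ext_n.
split=> [[xs xB]|->]; first exact: point_ext.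
by rewrite ext_point_max; split=> // j jB; apply: ext_point.
Qed.

Lemma reduction_transition (x y : state reduction) :
  transition x y <->
  (forall j, (j < K + L) -> ext y j = ext x (j + K)) /\
  table_holds step_bits
    (fun i => if i < K + K then ext x i else ext x (i + L))
    (fun i => ext y (K + L + i)).
Proof.
rewrite /transition (@sat_sys n [::] x isT) (sat_sys _ (all_upd_rows L step_bits)).
rewrite upd_rowsP; last by rewrite ext_col_mxr // ext_n.
have in_x i : i < n -> ext (col_mx x y) i = ext x i by move=> ?; apply: ext_col_mxl.
have in_y i : i <= n -> ext (col_mx x y) (n + i) = ext y i by move=> ?; apply: ext_col_mxr.
have sh : (forall j, j < K + L -> ext (col_mx x y) (n + j) = ext (col_mx x y) (j + K)) <->
    (forall j, j < K + L -> ext y j = ext x (j + K)).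
  by split=> H j jJ; have := H j jJ; rewrite in_y ?in_x //; rewrite /bits_dim; lia.
have tb : table_holds step_bits
      (fun i => if i < K + K then ext (col_mx x y) i else ext (col_mx x y) (i + L))
      (fun i => ext (col_mx x y) (n + (K + L) + i)) <->
    table_holds step_bits (fun i => if i < K + K then ext x i else ext x (i + L))
      (fun i => ext y (K + L + i)).
  have eqY r : r \in table step_bits ->
      (dot r.1.1 (fun i => if i < K + K then ext (col_mx x y) i
                           else ext (col_mx x y) (i + L)) =
       dot r.1.1 (fun i => if i < K + K then ext x i else ext x (i + L)) /\
       dot r.1.2 (fun i => ext (col_mx x y) (n + (K + L) + i)) =
       dot r.1.2 (fun i => ext y (K + L + i))).
    move=> /size_table[s1 s2]; split; apply: eq_dot => i; rewrite ?s1 ?s2 => si.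
      by case: ltnP => ?; rewrite in_x // /bits_dim; lia.
    by rewrite -addnA in_y // /bits_dim; lia.
  by split=> H r rt; have := H r rt; have [-> ->] := eqY r rt.
rewrite sh tb; split=> [[]|] //; split=> // -[[]] //.
Qed.

(** The shifted entries are copies of entries of [x], integers of any size; the others are
    determined because the table admits only 0/1 windows and assigns at most one output to each. *)
Lemma reduction_deterministic : deterministic reduction.
Proof.
move=> x gx y1 y2 u1 u2.
have /reduction_transition[sh1 /tableP[t1 [o1 [E1 t1E o1E z1]]]] : transition x y1 by [].
have /reduction_transition[sh2 /tableP[t2 [o2 [E2 t2E o2E z2]]]] : transition x y2 by [].
have tt : t1 = t2.
  apply/val_inj/(@eq_from_nth _ false); rewrite !size_tuple // => i iI.
  by have := t1E i iI; rewrite t2E //; case: nth; case: nth.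
have oo : o1 = o2 by move: E1; rewrite tt E2 => -[].
apply: ext_inj => j jn; case: (ltnP j (K + L)) => jJ; first by rewrite sh1 ?sh2.
rewrite -(subnKC jJ); set i := j - _.
have : i <= K + G by rewrite /i; move: (jn : j < n); rewrite /bits_dim; lia.
rewrite leq_eqVlt => /predU1P[->|iO]; first by rewrite z1 z2.
by rewrite o1E // o2E // oo.
Qed.

(** The shift drops the bits of the front letter and moves those of the other letters up by [K]; the
    table places the rewritten letter behind them and replaces the control. This is one step of the
    queue. *)
Lemma point_transition q x (y : state reduction) : well_sized q ->
  transition (point q x) y <-> ~~ accepts q.2 /\ y = point (queue_step q) (x - 1)%R.
Proof.
case: q => -[|a [|a2 u]] s // [uR].
set q := (_, s); have qok : well_sized q by rewrite /well_sized /= uR.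
have Bq : queue_bits q = (code a ++ code a2) ++ codes u ++ code s by rewrite bitsE /= -!catA.
have inE' i : i < K + K + G ->
    (if i < K + K then ext (point q x) i else ext (point q x) (i + L)) =
    (nth false (code a ++ code a2 ++ code s) i)%:Z%R.
  move=> iI; have sA : size (code a ++ code a2) = K + K by rewrite size_cat !size_code.
  rewrite catA nth_cat sA; case: ltnP => iK.
    rewrite ext_point; last by rewrite /bits_dim; lia.
    by rewrite Bq nth_cat sA iK.
  rewrite ext_point; last by rewrite /bits_dim; lia.
  rewrite Bq nth_cat sA ltnNge (leq_trans iK) ?leq_addr //= nth_cat size_codes uR.
  by rewrite ltnNge -addnBAC // leq_addl /= addnK.
set y' := queue_rule a a2 s.
have Bq' : queue_bits (queue_step q) = codes (a2 :: u) ++ (code y'.1 ++ code y'.2).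
  rewrite /queue_step /= -/y' bitsE -rcons_cons -cats1 /codes map_cat flatten_cat.
  by rewrite /= cats0 -!catA.
have su : size (codes (a2 :: u)) = K + L by rewrite size_codes /= uR mulnS.
have nok : well_sized (queue_step q) by apply: step_well_sized.
have shq j : j < K + L ->
    nth false (queue_bits (queue_step q)) j = nth false (queue_bits q) (j + K).
  move=> jJ; rewrite Bq' nth_cat su jJ Bq -catA nth_cat size_code.
  by rewrite ltnNge leq_addl /= addnK catA -/(codes (a2 :: u)) nth_cat su jJ.
have into (t : (K + K + G).-tuple bool) o :
    (forall i, i < K + K + G ->
       (if i < K + K then ext (point q x) i else ext (point q x) (i + L)) =
       (nth false t i)%:Z%R) ->
    step_bits t = Some o <-> ~~ accepts s /\ tval o = code y'.1 ++ code y'.2.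
  move=> tE; apply: step_bits_code.
  apply: (@eq_from_nth _ false) => [|i].
    by rewrite size_tuple !size_cat !size_code addnA.
  by rewrite size_tuple => iI; have := tE i iI; rewrite inE' //; case: nth; case: nth.
rewrite reduction_transition; split=> [[sh /tableP[t [o [to tE oE zE]]]]|[na ->]].
  have [na oE'] := (into t o tE).1 to; split=> //.
  apply: point_ext => [j jB|].
    case: (ltnP j (K + L)) => jJ.
      rewrite sh // ext_point ?shq //; rewrite /bits_dim; lia.
    rewrite Bq' nth_cat su ifN -?leqNgt // -oE' -oE ?subnKC //.
    by move: jB; rewrite /bits_dim; lia.
  (* Index [B], the counter, is the entry after the last bit in the output window as well as in the
     input window. *)
  have -> : B = K + L + (K + G) by rewrite /bits_dim; lia.
  rewrite zE ltnNge; have -> /= : (K + K <= K + K + G) by rewrite leq_addr.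
  by have -> : K + K + G + L = B; [rewrite /bits_dim; lia | rewrite ext_point_max].
split=> [j jJ|].
  have b1 : j < B by rewrite /bits_dim; lia.
  have b2 : j + K < B by rewrite /bits_dim; lia.
  apply: (etrans (ext_point _ _ b1)); apply: esym; apply: (etrans (ext_point _ _ b2)).
  by rewrite (shq j jJ).
have st : size (code a ++ code a2 ++ code s) == K + K + G.
  by rewrite !size_cat !size_code addnA.
have so : size (code y'.1 ++ code y'.2) == K + G by rewrite size_cat !size_code.
apply/tableP; exists (Tuple st), (Tuple so); split=> //.
- by apply/into.
- move=> j jO; rewrite ext_point; last by rewrite /bits_dim; lia.
  by rewrite Bq' nth_cat su ltnNge leq_addr /= addKn.
- have -> : K + L + (K + G) = B by rewrite /bits_dim; lia.
  rewrite ltnNge; have -> /= : (K + K <= K + K + G) by rewrite leq_addr.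
  have -> : K + K + G + L = B by rewrite /bits_dim; lia.
  by apply: (etrans (ext_point_max _ _)); rewrite (ext_point_max q x).
Qed.

Lemma queue_bits_inj q r : well_sized q -> well_sized r ->
  (forall j : 'I_n, j != ord_max ->
     nth false (queue_bits q) j = nth false (queue_bits r) j) -> q = r.
Proof.
case: q r => [u s] [v s'] qR rR H.
have : queue_bits (u, s) = queue_bits (v, s').
  apply: (@eq_from_nth _ false); rewrite !size_bits // => j jB.
  by apply: (H (Ordinal (ltnW jB : j < n))); rewrite -val_eqE /= ltn_eqF.
rewrite !bitsE => /eqP; have uv : size u = size v by rewrite -[LHS]/(size (u, s).1) qR rR.
rewrite eqseq_cat ?size_codes ?uv // => /andP[/eqP cuv /eqP/code_inj ->].
congr (_, _); clear -cuv uv; elim: u v uv cuv => [|a u IH] [|b v] //= [uv] /eqP.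
by rewrite eqseq_cat ?size_code // => /andP[/eqP/code_inj -> /eqP/IH ->].
Qed.

Lemma reduction_correct :
  has_ranking_with_invariant reduction <->
  exists t, accepts (iter t queue_step start_queue).2.
Proof.
split.
  move=> H; apply: (@ranking_stop reduction ord_max queue queue_step
    (fun q => accepts q.2) well_sized start_queue (fun q j => nth false (queue_bits q) j)) => //.
  - exact: start_well_sized.
  - exact: step_well_sized.
  - exact: reduction_initial.
  - by move=> q x y; apply: point_transition.
move=> H; apply: (@stop_ranking reduction ord_max queue queue_step
  (fun q => accepts q.2) well_sized start_queue (fun q j => nth false (queue_bits q) j)) => //.
- exact: start_well_sized.
- exact: step_well_sized.
- exact: queue_bits_inj.
- exact: reduction_initial.
- by move=> q x y; apply: point_transition.
Qed.

End Reduction.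

(** * Printing the encoding *)

Definition off_rails (T : finType) (x : T) : seq int :=
  ints_of (rails (map negb (one_hot x))).

Section Generator.
Variables (M : tm) (c e : nat).

Local Notation letter := (letter M).
Local Notation control := (control M).
Local Notation k := #|letter|.
Local Notation g := #|control|.
Local Notation K := (2 * k).
Local Notation G := (2 * g).
Local Notation zeros := (zeros c e).
Local Notation band_gen := (band_gen c e).
Local Notation dim_gen := (dim_gen c e).

Definition blank_letter : letter := Some (start_cell (tm_blank M)).
Definition bit_letter (b : bool) : letter := Some (start_cell (tm_bit M b)).

(** The constants come from B = K R + (2K + G) and the gap lengths of bands. In the last row each
    letter of the input selects one of two blocks of coefficients; everything before it depends on
    the length of the input only. *)
Definition pre_gen : gen := emit_all
  [:: dim_gen (2 * K) (4 * K + 2 * G + 5);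
      band_gen (ints [:: -1]%R) K (2 * K + G + 1) K (2 * K + G + 2) 0 1;
      band_gen (ints [:: 1; 1; -1; -1]%R) k (2 * k + g).-1 K (2 * K + G) 0 4;
      band_gen (ints [:: -1; -1; 1; 1]%R) k (2 * k + g).-1 K (2 * K + G) 0 4;
      ints [:: 1; 1]%R; zeros K (2 * K + G).-1; ints [:: 1]%R;
      ints [:: -1; -1]%R; zeros K (2 * K + G).-1; ints [:: -1]%R;
      Rep (ints (off_rails (bit_letter true))) (ints (off_rails (bit_letter false)));
      power c e (ints (off_rails blank_letter));
      ints (off_rails blank_letter ++ off_rails (None : letter) ++
            off_rails (start_control M) ++ [:: 1; 0]%R)].

Definition core_gen (d : int) : gen := emit_all
  [:: ints (nseq K 0%R ++ [:: (- d)%R]); zeros K (K + G); ints [:: d]].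

Definition row_gen (r : seq int * seq int * int) : gen := emit_all
  [:: ints (take (K + K) r.1.1); zeros K 0; ints (drop (K + K) r.1.1);
      zeros K K; ints (r.1.2 ++ [:: r.2])].

Definition rows_gen (rs : seq (seq int * seq int * int)) : gen :=
  emit_all [seq row_gen r | r <- rs].

Definition upd_gen : gen := emit_all
  [:: dim_gen (2 * K) (2 * K + 2 + size (table (@step_bits M)));
      band_gen (core_gen 1) K K K (2 * K + G + 2) K (3 * K + 2 * G + 3);
      band_gen (core_gen (-1)) K K K (2 * K + G + 2) K (3 * K + 2 * G + 3);
      rows_gen (table (@step_bits M))].

(** The lone [Out false] is the code of the guard, a system with 0 rows. *)
Definition reduction_gen : gen := emit_all
  [:: dim_gen K (2 * K + G + 1); pre_gen; Out false; upd_gen].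

Variable w : seq bool.

Local Notation R := (width c e w).
Local Notation P := ((size w + c) ^ e).
Local Notation L := (K * R).
Local Notation B := (bits_dim K L G).
Local Notation n := B.+1.

Lemma start_letters : (start_queue M c e w).1 =
  [seq bit_letter b | b <- w] ++ nseq P blank_letter ++ [:: blank_letter; None].
Proof.
rewrite /start_queue /start /= /mid_queue; set u := mkseq _ _.
rewrite -[RHS]/(_ ++ nseq P blank_letter ++ [:: blank_letter] ++ [:: None]).
rewrite drop0 take0 !catA; congr (_ ++ _).
apply: (@eq_from_nth _ None) => [|i].
  by rewrite size_mkseq !size_cat size_map size_nseq /= addn1.
rewrite size_mkseq => iR; rewrite nth_mkseq //= /word_tape -catA nth_cat size_map.
case: ltnP => iw; first by rewrite !(nth_map false).
rewrite nth_default ?size_map // nth_cat size_nseq nth_nseq.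
case: ltnP => // iP; have -> : i - size w - P = 0 by move: iR; rewrite /width; lia.
by [].
Qed.

Lemma off_rails_bits : ints_of (rails (map negb (raw_bits (start_queue M c e w)))) =
  flatten [seq off_rails (bit_letter b) | b <- w] ++
  flatten (nseq P (off_rails blank_letter)) ++
  off_rails blank_letter ++ off_rails (None : letter) ++ off_rails (start_control M).
Proof.
have catE s t : ints_of (rails (map negb (s ++ t))) =
    ints_of (rails (map negb s)) ++ ints_of (rails (map negb t)).
  by rewrite map_cat rails_cat /ints_of map_cat.
have flatE (u : seq letter) :
    ints_of (rails (map negb (flatten [seq one_hot a | a <- u]))) =
    flatten [seq off_rails a | a <- u].
  by elim: u => //= a u IH; rewrite catE IH.
rewrite /raw_bits catE flatE start_letters !map_cat !flatten_cat -map_comp map_nseq.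
by rewrite /= cats0 -!catA.
Qed.

Lemma eval_pre_gen : eval pre_gen w =
  encode_linsys (sys n (pre_rows (raw_bits (start_queue M c e w)))).
Proof.
have k0 := letter_gt0 M; have B0 := size_start_bits M c e w.
have s0 : 0 < size (raw_bits (start_queue M c e w)).
  by rewrite size_raw_bits start_well_sized; lia.
have := all_pre_rows s0; rewrite B0 => szs; rewrite encode_sys //.
have sE : size (raw_bits (start_queue M c e w)) = k * R + (2 * k + g).
  by rewrite size_raw_bits start_well_sized; lia.
have BE : B = K * R + (2 * K + G) by rewrite /bits_dim; lia.
have dimE : eval (dim_gen (2 * K) (4 * K + 2 * G + 5)) w =
    encode_dim (size (pre_rows (raw_bits (start_queue M c e w)))).
  by apply: eval_dim; rewrite size_pre_rows // sE; lia.
have pairE (u : seq int) : size u = 4 ->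
    eval (band_gen (ints u) k (2 * k + g).-1 K (2 * K + G) 0 4) w =
    encode_ints (flatten (band u 2 (size (raw_bits (start_queue M c e w))).-1 B.+2)).
  by move=> u4; apply: eval_band; rewrite ?eval_ints ?u4 //; lia.
have zerosE : eval (zeros K (2 * K + G).-1) w = encode_ints (nseq B.-1 0%R).
  by apply: eval_zeros; lia.
have inputE : eval (Rep (ints (off_rails (bit_letter true)))
      (ints (off_rails (bit_letter false)))) w =
    encode_ints (flatten [seq off_rails (bit_letter b) | b <- w]).
  rewrite /eval -/eval !eval_ints; elim: (w) => // b v /= ->.
  by rewrite encode_ints_cat; case: b.
have negE : eval (band_gen (ints [:: -1]%R) K (2 * K + G + 1) K (2 * K + G + 2) 0 1) w =
    encode_ints (flatten (band [:: -1]%R 1 B.+1 B.+2)).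
  by apply: eval_band; rewrite ?eval_ints // -?[size [:: _]]/1; lia.
rewrite eval_all !map_cons !flatten_cons cats0 dimE !pairE // negE.
rewrite zerosE inputE eval_power !eval_ints.
rewrite -!encode_nseq -!encode_ints_cat; congr (_ ++ encode_ints _).
rewrite /pre_rows B0 !flatten_cat off_rails_bits.
by rewrite [flatten [:: _; _; _]]/= cats0 -!catA.
Qed.

Lemma eval_core_gen d : eval (core_gen d) w = encode_ints (shift_core K L G d).
Proof.
rewrite eval_all !map_cons !flatten_cons cats0 !eval_ints.
rewrite (@eval_zeros _ _ _ _ _ (K + L + G)); last lia.
by rewrite -!encode_ints_cat /shift_core -!catA.
Qed.

Lemma eval_row_gen r : eval (row_gen r) w = encode_ints (table_row K L r).
Proof.
rewrite eval_all !map_cons !flatten_cons cats0 !eval_ints.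
rewrite (@eval_zeros _ _ _ _ _ L); last lia.
rewrite (@eval_zeros _ _ _ _ _ (K + L)); last lia.
by rewrite -!encode_ints_cat /table_row.
Qed.

Lemma eval_rows_gen rs :
  eval (rows_gen rs) w = encode_ints (flatten [seq table_row K L r | r <- rs]).
Proof.
rewrite eval_all -map_comp; elim: rs => // r rs IH.
by rewrite !map_cons !flatten_cons encode_ints_cat -IH -eval_row_gen.
Qed.

Lemma eval_upd_gen : eval upd_gen w =
  encode_linsys (sys (n + n) (upd_rows L (@step_bits M))).
Proof.
rewrite encode_sys; last exact: all_upd_rows.
have BE : B = K * R + (2 * K + G) by rewrite /bits_dim; lia.
have dimE : eval (dim_gen (2 * K) (2 * K + 2 + size (table (@step_bits M)))) w =
    encode_dim (size (upd_rows L (@step_bits M))).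
  by apply: eval_dim; rewrite size_upd_rows; lia.
have bandE d : eval (band_gen (core_gen d) K K K (2 * K + G + 2) K (3 * K + 2 * G + 3)) w =
    encode_ints (flatten (band (shift_core K L G d) 1 (K + L) (n + n).+1)).
  by apply: eval_band; rewrite ?eval_core_gen ?size_shift_core ?BE //; lia.
rewrite eval_all !map_cons !flatten_cons cats0 dimE !bandE eval_rows_gen.
congr (_ ++ _); rewrite /upd_rows; move: (table _) => rs.
by rewrite !flatten_cat !encode_ints_cat.
Qed.

Lemma eval_reduction_gen : eval reduction_gen w = encode_loop (reduction M c e w).
Proof.
rewrite eval_all !map_cons !flatten_cons cats0 eval_pre_gen eval_upd_gen /encode_loop.
rewrite (@eval_dim _ _ _ _ _ n); last by rewrite /bits_dim; lia.
by rewrite [encode_linsys (loop_guard _)]encode_sys.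
Qed.

End Generator.

(** Induction along Horner's scheme: multiplication by the variable raises the exponent, and the new
    constant term is absorbed by enlarging the base, whose successor keeps the power positive. *)
Lemma poly_bound (p : {poly nat}) :
  exists c e, forall n, (p.[n])%R <= (n + c) ^ e.
Proof.
elim/poly_ind: p => [|p a [c [e IH]]].
  by exists 0, 0 => n; rewrite horner0.
exists (c + a).+1, e.+1 => n.
rewrite hornerMXaddC; apply: (@leq_trans ((n + c) ^ e * n + a)).
  by rewrite leq_add2r leq_mul2r IH orbT.
have pos : 0 < (n + (c + a).+1) ^ e by rewrite expn_gt0 addnS.
have le : (n + c) ^ e <= (n + (c + a).+1) ^ e.
  by case: (e) => // e'; rewrite leq_exp2r //; lia.
rewrite expnSr mulnDr leq_add ?leq_mul //.
by apply: leq_trans (leq_pmull _ pos); rewrite ltnW // ltnS leq_addl.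
Qed.

Theorem theorem5 :
  PSPACE_hard encode_loop deterministic has_ranking_with_invariant.
Proof.
move=> L [M [ML [p pM]]]; have [c [e pE]] := poly_bound p.
exists (reduction M c e); split.
- exact: (@poly_time_eval _ (reduction_gen M c e) (@eval_reduction_gen M c e)).
- exact: reduction_deterministic.
move=> w; rewrite reduction_correct (decides_accepted w ML) queue_accepts //.
(* The polynomial space bound is at most (|w| + c)^e, hence below the [R.+1] cells of the queue. *)
move=> t i; apply: leq_trans (pM w t i) _; apply: leq_trans (pE _) _.
by rewrite /width leqW // leq_addl.
Qed.
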